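(* Suppose that $B_c'(1)<0$ and $\mu_1<\infty$, and let $(\tilde\pi_k)_{k\ge0}$ be the equilibrium distribution of the process with $q$-matrix $\tilde Q$. The equilibrium queue size $N$ has expectation $$E(N)=\tilde\pi_0\Big[\frac{B_c''(1)\mu_1}{2(B_c'(1))^2}-\frac{2\mu_1+H''(1)}{2B_c'(1)}\Big]+\sum_{k=1}^{c-1}\tilde\pi_k(c-k)b_0\Big[\frac{B_c''(1)}{2(B_c'(1))^2}-\frac{k}{B_c'(1)}\Big]$$ if both $B_c''(1)$ and $H''(1)$ are finite, and $E(N)=\infty$ otherwise. The equilibrium waiting queue size $L_w$ has expectation $$E(L_w)=\tilde\pi_0\Big[\frac{B_c''(1)\mu_1}{2(B_c'(1))^2}-\frac{2\mu_1+H''(1)}{2B_c'(1)}+c\Big]+\sum_{k=1}^{c-1}\tilde\pi_k(c-k)\Big[b_0\Big(\frac{B_c''(1)}{2(B_c'(1))^2}-\frac{k}{B_c'(1)}\Big)+1\Big]-c$$ if both $B_c''(1)$ and $H''(1)$ are finite, and $E(L_w)=\infty$ otherwise. Here $\tilde\pi_0=-B_c'(1)\big[-B_c'(1)+\mu_1+\sum_{k=1}^{c-1}r_k(c-k)b_0\big]^{-1}$ and $\tilde\pi_k=\tilde\pi_0r_k$ for $1\le k\le c-1$.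
   Context: Let $\mathbf E=\{0,1,2,\dots\}$ and let $c\ge 1$ be an integer (the number of servers). Let $(b_j)_{j\ge0}$ be reals with $b_j\ge 0$ for $j\ne 1$, $0<-b_1=\sum_{j\ne1}b_j<\infty$, $b_0>0$ and $\sum_{j\ge2}b_j>0$. Let $h_j\ge0$ ($j\ge1$) with $0<h:=\sum_{j\ge1}h_j<\infty$. The stopped queue has $q$-matrix $Q^*=(q^*_{ij})$ on $\mathbf E$: for $i\ge1$, $q^*_{i,i-1}=\min(i,c)b_0$, $q^*_{ii}=b_1-[\min(i,c)-1]b_0$, $q^*_{ij}=b_{j-i+1}$ ($j\ge i+1$); all other entries $0$. Its transition function is $(p^*_{ij}(t))$, and $m^*_k(i)=\int_0^\infty p^*_{ik}(t)\,dt$ for $i,k\ge1$; $r_k:=\sum_{i\ge1}h_im^*_k(i)$. The $M^X/M/c$ queue with resurrection is the Markov chain with $q$-matrix $\tilde Q$ that agrees with $Q^*$ in every row $i\ge1$ and has row $0$ given by $\tilde q_{00}=-h$, $\tilde q_{0j}=h_j$ ($j\ge1$). Define $B(s)=\sum_{j\ge0}b_js^j$, $B_c(s)=B(s)+(c-1)b_0(1-s)$, $H(s)=\sum_{j\ge1}h_js^j$, $\mu_1=H'(1)=\sum_{j\ge1}jh_j$; derivatives at $1$ are left derivatives, and $B_c''(1)=\sum_{j\ge2} j(j-1)b_j$, $H''(1)=\sum_{j\ge2}j(j-1)h_j$ may be $+\infty$. When $B_c'(1)<0$ and $\mu_1<\infty$ the chain is positive recurrent; $N$ is a random variable with its equilibrium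 distribution, and $L_w=\max(N-c,0)$ is the number of waiting customers. *)

(* Defs.v *)
From HB Require Import structures.
From mathcomp Require Export all_boot all_order all_algebra.
From mathcomp Require Export all_classical all_reals all_analysis.
Export Order.TTheory GRing.Theory Num.Theory.
Export numFieldNormedType.Exports.

Set Implicit Arguments.
Unset Strict Implicit.
Unset Printing Implicit Defensive.

Local Open Scope classical_set_scope.
Local Open Scope ring_scope.

Section MarkovChains.
Variable R : realType.
Implicit Types (Q : nat -> nat -> R) (p : R -> nat -> nat -> R) (pi : nat -> R).

(* Standard transition function on the state space {0, 1, 2, ...}; [p t i j]
   is only constrained for [0 <= t], and a priori rows may sum to less
   than 1. *)
Record transition_function p : Prop := TransitionFunction {
  tf_ge0 : forall t i j, 0 <= t -> 0 <= p t i j ;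
  tf_le1 : forall t i, 0 <= t -> (\sum_(0 <= j <oo) (p t i j)%:E <= 1)%E ;
  tf_0 : forall i j, p 0 i j = (i == j)%:R ;
  tf_chapman_kolmogorov : forall s t i j, 0 <= s -> 0 <= t ->
    ((p (s + t) i j)%:E = \sum_(0 <= k <oo) (p s i k * p t k j)%:E)%E ;
  tf_standard : forall i j, p t i j @[t --> 0^'+] --> ((i == j)%:R : R) }.

(* [p] has q-matrix [Q] : the right derivative of [p _ i j] at 0 is [Q i j].
   When [Q] is bounded and conservative (as [Qstar] and [Qtilde] below are),
   this determines [p t] for all [0 <= t]. *)
Definition has_qmatrix p Q : Prop := forall i j,
  (p t i j - p 0 i j) / t @[t --> 0^'+] --> Q i j.

Record equilibrium_distribution p pi : Prop := EquilibriumDistribution {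
  eq_ge0 : forall k, 0 <= pi k ;
  eq_sum1 : (\sum_(0 <= k <oo) (pi k)%:E = 1)%E ;
  eq_stationary : forall t j, 0 <= t ->
    (\sum_(0 <= i <oo) (pi i * p t i j)%:E = (pi j)%:E)%E }.

Definition left_derivative (f : R -> R) (x : R) : \bar R :=
  lim ((((f y - f x) / (y - x))%:E) @[y --> x^'-]).

End MarkovChains.

Section BulkArrivalQueue.
Variables (R : realType) (c : nat) (b h : nat -> R).

Definition Qstar (i j : nat) : R :=
  if i == 0%N then 0
  else if j.+1 == i then (minn i c)%:R * b 0%N
  else if j == i then b 1%N - ((minn i c)%:R - 1) * b 0%N
  else if (i < j)%N then b (j - i + 1)%N
  else 0.

(* Only the values [h j] with [1 <= j] are meaningful, here and below. *)
Definition total_resurrection_rate : \bar R :=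
  (\sum_(1 <= j <oo) (h j)%:E)%E.

Definition Qtilde (i j : nat) : R :=
  if i == 0%N then
    if j == 0%N then - fine total_resurrection_rate else h j
  else Qstar i j.

Definition mstar (pstar : R -> nat -> nat -> R) (k i : nat) : \bar R :=
  (\int[lebesgue_measure]_(t in `[0%R, +oo[) (pstar t i k)%:E)%E.

Definition resurrection_occupation (pstar : R -> nat -> nat -> R) (k : nat) :
    \bar R :=
  (\sum_(1 <= i <oo) (h i)%:E * mstar pstar k i)%E.

Definition B (s : R) : R := limn (pseries b s).

Definition Bc (s : R) : R := B s + (c%:R - 1) * b 0%N * (1 - s).

Definition dBc1 : \bar R := left_derivative Bc 1.

(* The first and second left derivatives at 1 of power series are written as
   the series of their coefficients, with value possibly [+oo]; the terms of
   degree at most 1 of [Bc] do not contribute to its second derivative. *)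
Definition ddBc1 : \bar R := (\sum_(2 <= j <oo) ((j * j.-1)%:R * b j)%:E)%E.

Definition mu1 : \bar R := (\sum_(1 <= j <oo) (j%:R * h j)%:E)%E.

Definition ddH1 : \bar R := (\sum_(2 <= j <oo) ((j * j.-1)%:R * h j)%:E)%E.

End BulkArrivalQueue.

(* Main.v *)
Require Import Defs.
From mathcomp Require Import measurable_realfun ring lra zify.

Set Implicit Arguments.
Unset Strict Implicit.
Unset Printing Implicit Defensive.

Local Open Scope classical_set_scope.
Local Open Scope ring_scope.

(** The mean queue length comes out of two drift identities in equilibrium.
    Downward jumps have size 1, so the flow across the cut between [n] and
    [n.+1] has a single downward term, and [cut_balance] equates it with the
    total upward rate across the cut.  Multiplying by a weight [w n >= 0] and
    summing over [n] involves nonnegative terms only: Tonelli applies and no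
    moment has to be known to be finite ([drift_balance], [weighted_drift]).
    The weights [w n = 1] give a linear relation between [pi 0], [mu1 h] and the
    [pi k] with [1 <= k < c]; the weights [w n = 2 * n] give the relation
    between the mean and the second moments of batches and resurrections.  As
    the mean drift [dBc1 c b] of a fully busy system is negative, the second
    relation can be solved for the mean; when the second moments are finite, the
    same identity with weights cut off at [M] shows that the mean is finite
    ([mean_queue_fin]), and when one of them is infinite the identity forces the
    mean to be infinite ([mean_queue_infty]).

    The probabilities [pi k] with [1 <= k < c] are identified with
    [pi 0 * r k] by running the stopped chain from the equilibrium of the
    resurrected one ([equilibrium_occupation]).  The two chains differ only by
    the restarts, so the probability that the stopped chain is in state [k] at
    time [T] decreases at rate [pi 0] times the flux started by one restart at
    time 0.  It decreases from [pi k] to 0, because the mass in the states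
    [k > 0] keeps leaking into the absorbing state; integrating over all times
    gives the claim.

    Nothing beyond the derivatives at 0 is known of the transition functions.
    The link to the rates is [short_time_error_sum]: for bounded conservative
    rates, the deviation of [p t] from its first-order expansion has total mass
    of order [t ^+ 2], uniformly in the starting state, and may thus be averaged
    over an equilibrium distribution or summed over many short time steps. *)

(** * Transition functions at short times *)

Lemma ler_vanishing_error (R : realFieldType) (a b c : R) :
  0 <= c -> (forall e, 0 < e -> a <= b + c * e) -> a <= b.
Proof.
move=> c0 ab; rewrite leNgt; apply/negP => ba.
have := ab ((a - b) / (2 * (c + 1))) ltac:(apply: divr_gt0; lra).
have -> : c * ((a - b) / (2 * (c + 1))) = (a - b) / 2 * (c / (c + 1)).
  by field; apply: lt0r_neq0; lra.
have : c / (c + 1) <= 1 by rewrite ler_pdivrMr; lra.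
nra.
Qed.

Section Transition.
Variables (R : realType) (p : R -> nat -> nat -> R).
Hypothesis tf : transition_function p.
Implicit Types (s t : R) (i j k l n : nat).

Lemma transition_ge_sum s t i j n : 0 <= s -> 0 <= t ->
  \sum_(k < n) p s i k * p t k j <= p (s + t) i j.
Proof.
move=> s0 t0; rewrite -lee_fin (tf_chapman_kolmogorov tf)// -sumEFin.
rewrite -(big_mkord xpredT (fun k => (p s i k * p t k j)%:E)).
by apply: nneseries_lim_ge => k _ _; rewrite lee_fin mulr_ge0// (tf_ge0 tf).
Qed.

Lemma transition_ge_via s t i k j : 0 <= s -> 0 <= t ->
  p s i k * p t k j <= p (s + t) i j.
Proof.
move=> s0 t0; apply: le_trans (transition_ge_sum i j k.+1 s0 t0).
rewrite big_ord_recr/= lerDr sumr_ge0// => l _.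
by rewrite mulr_ge0// (tf_ge0 tf).
Qed.

Lemma transition_ge_via2 s t i k l j : 0 <= s -> 0 <= t -> k != l ->
  p s i k * p t k j + p s i l * p t l j <= p (s + t) i j.
Proof.
move=> s0 t0 kl; apply: le_trans (transition_ge_sum i j (maxn k l).+1 s0 t0).
have hk : (k < (maxn k l).+1)%N by rewrite ltnS leq_maxl.
have hl : (l < (maxn k l).+1)%N by rewrite ltnS leq_maxr.
rewrite (bigD1 (Ordinal hk))//= (bigD1 (Ordinal hl))/=; last first.
  by apply: contra kl => /eqP[->].
rewrite addrA lerDl sumr_ge0// => m _.
by rewrite mulr_ge0// (tf_ge0 tf).
Qed.

Lemma transition_le1 t i j : 0 <= t -> p t i j <= 1.
Proof.
move=> t0; rewrite -lee_fin; apply: le_trans (tf_le1 tf i t0).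
rewrite (nneseriesD1 (n := j))//; last by move=> k _; rewrite lee_fin (tf_ge0 tf).
by rewrite leeDl// nneseries_ge0// => k _ _; rewrite lee_fin (tf_ge0 tf).
Qed.

End Transition.

(** The bound [K], common to all states, is what makes the short-time estimates
    uniform in the starting state, so that they can be averaged over it. *)
Record bounded_conservative (R : realType) (K : R) (Q : nat -> nat -> R) :
    Prop := BoundedConservative {
  bc_offdiag_ge0 : forall i j, j != i -> 0 <= Q i j ;
  bc_row : forall i,
    (\sum_(0 <= j <oo | j != i) (Q i j)%:E = (- Q i i)%:E)%E ;
  bc_exit_le : forall i, - Q i i <= K }.

Section ShortTime.
Variables (R : realType) (p : R -> nat -> nat -> R) (Q : nat -> nat -> R) (K : R).
Hypotheses (tf : transition_function p) (pQ : has_qmatrix p Q).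
Hypothesis bc : bounded_conservative K Q.
Implicit Types (s t : R) (i j k l n : nat).

Lemma exit_rate_ge0 i : 0 <= - Q i i.
Proof.
rewrite -lee_fin -(bc_row bc); apply: nneseries_ge0 => j _ ji.
by rewrite lee_fin (bc_offdiag_ge0 bc).
Qed.

Lemma exit_bound_ge0 : 0 <= K.
Proof. exact: le_trans (exit_rate_ge0 0) (bc_exit_le bc 0). Qed.

Lemma rate_le_exit i j : j != i -> Q i j <= - Q i i.
Proof.
move=> ji; rewrite -lee_fin -(bc_row bc) (nneseriesD1 (n := j))//; last first.
  by move=> k ki; rewrite lee_fin (bc_offdiag_ge0 bc).
rewrite leeDl// nneseries_ge0// => k _ /andP[ki _].
by rewrite lee_fin (bc_offdiag_ge0 bc).
Qed.

Lemma qmatrix_slope e i j : 0 < e -> exists2 d, 0 < d &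
  forall s, 0 < s < d -> `|(p s i j - (i == j)%:R) / s - Q i j| < e.
Proof.
move=> e0; have /cvgrPdist_lt /(_ _ e0) := @pQ i j.
rewrite near_withinE /= => -[d /= d0 H]; exists d => // s /andP[s0 sd].
rewrite distrC -(tf_0 tf); apply: H => //=.
by rewrite sub0r normrN gtr0_norm.
Qed.

Lemma archimedean_step t d : 0 < d -> 0 <= t -> exists n, t / n.+1%:R < d.
Proof.
move=> d0 t0; exists (Num.truncn (t / d)).
rewrite ltr_pdivrMr// mulrC -ltr_pdivrMr//.
by rewrite truncnS_gt.
Qed.

Lemma diag_ge_linear i a s n : 0 <= a -> 0 <= s -> 1 - a * s <= p s i i ->
  1 - a * s * n%:R <= p (s * n%:R) i i.
Proof.
move=> a0 s0 H; elim: n => [|n IH]; first by rewrite !mulr0 (tf_0 tf) eqxx subr0.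
have sn0 : 0 <= s * n%:R by rewrite mulr_ge0.
rewrite -natr1 !mulrDr !mulr1; apply: le_trans (transition_ge_via tf _ i _ _ _) => //.
have := transition_le1 tf i i sn0; have := tf_ge0 tf i i sn0.
have : 0 <= a * s by rewrite mulr_ge0.
move: H IH; move: (p _ _ _) (p _ _ _) (a * s) => u v w; move: (n%:R) => m; nra.
Qed.

(** Since [p (s + t) i i >= p s i i * p t i i], the derivative at 0 controls all
    times, by Bernoulli's inequality. *)
Lemma diag_ge t i : 0 <= t -> 1 + t * Q i i <= p t i i.
Proof.
move=> t0; apply: (ler_vanishing_error t0) => e e0.
have [d d0 H] := qmatrix_slope i i e0.
have [->|tn0] := eqVneq t 0.
  by rewrite !mul0r !addr0 (tf_0 tf) eqxx.
have tp : 0 < t by rewrite lt_neqAle eq_sym tn0.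
have [n nd] := archimedean_step d0 t0.
set s := t / n.+1%:R in nd.
have s0 : 0 < s by rewrite divr_gt0.
have ts : t = s * n.+1%:R by rewrite /s divfK.
have := H s; rewrite s0 nd eqxx => /(_ isT).
rewrite ltr_norml => /andP[+ _].
rewrite ltrBrDr ltr_pdivlMr// => Hs.
have qi := exit_rate_ge0 i.
have /(diag_ge_linear n.+1) : 1 - (e - Q i i) * s <= p s i i.
  by move: Hs; rewrite mulr1n; lra.
rewrite -mulrA -ts; move/(_ ltac:(lra) (ltW s0)); lra.
Qed.

Lemma diag_ge_bound t i : 0 <= t -> 1 - K * t <= p t i i.
Proof.
by move=> t0; have := diag_ge i t0; have := bc_exit_le bc i; nra.
Qed.

Lemma offdiag_ge_linear i j s n : j != i -> 0 <= s -> K * s <= 1 ->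
  n%:R * p s i j * (1 - K * (s * n%:R)) <= p (s * n%:R) i j.
Proof.
move=> ji s0 Ks; elim: n => [|n IH].
  by rewrite !mul0r mulr0 (tf_0 tf) eq_sym (negPf ji).
have sn0 : 0 <= s * n%:R by rewrite mulr_ge0.
have -> : s * n.+1%:R = s * n%:R + s by rewrite -natr1 mulrDr mulr1.
have ij : i != j by rewrite eq_sym.
apply: le_trans (transition_ge_via2 tf i j sn0 s0 ij).
have A := diag_ge_bound i sn0.
have B := diag_ge_bound j s0.
have C := tf_ge0 tf i j s0.
have C' := tf_ge0 tf i j sn0.
have D : (1 - K * (s * n%:R)) * p s i j <= p (s * n%:R) i i * p s i j.
  by rewrite ler_wpM2r.
have E : (n%:R * p s i j * (1 - K * (s * n%:R))) * (1 - K * s)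
    <= p (s * n%:R) i j * p s j j.
  apply: le_trans (_ : p (s * n%:R) i j * (1 - K * s) <= _).
    by rewrite ler_wpM2r; lra.
  by rewrite ler_wpM2l.
apply: le_trans (lerD D E).
have K0 := exit_bound_ge0.
rewrite -natr1 -subr_ge0.
rewrite [leRHS](_ : _ = K * s * p s i j + (K * s) ^+ 2 * n%:R ^+ 2 * p s i j);
  last by ring.
by rewrite addr_ge0// !mulr_ge0// sqr_ge0.
Qed.

(** The jump may take place in any of [n] slots of length [t / n]; staying in [i]
    before it and in [j] after it costs at most the factor [1 - K * t]. *)
Lemma offdiag_ge t i j : j != i -> 0 <= t -> t * Q i j * (1 - K * t) <= p t i j.
Proof.
move=> ji t0.
have Q0 := bc_offdiag_ge0 bc ji.
have [Kt|Kt] := leP (1 - K * t) 0.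
  apply: le_trans (tf_ge0 tf i j t0).
  by rewrite mulr_ge0_le0// mulr_ge0.
have [->|tn0] := eqVneq t 0.
  by rewrite !mul0r (tf_0 tf).
have tp : 0 < t by rewrite lt_neqAle eq_sym tn0.
have tK : 0 <= t * (1 - K * t) by rewrite mulr_ge0 ?(ltW Kt).
apply: (ler_vanishing_error tK) => e e0.
have [d d0 H] := qmatrix_slope i j e0.
have [n nd] := archimedean_step d0 t0.
set s := t / n.+1%:R in nd.
have s0 : 0 < s by rewrite divr_gt0.
have ts : t = s * n.+1%:R by rewrite /s divfK.
have K0 := exit_bound_ge0.
have Ks : K * s <= 1.
  apply: le_trans (_ : K * t <= 1); last lra.
  by rewrite ler_wpM2l// ts ler_peMr ?(ltW s0)// ler1n.
have := H s; rewrite s0 nd eq_sym (negPf ji) => /(_ isT).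
rewrite ltr_norml => /andP[+ _].
rewrite ltrBrDr ltr_pdivlMr// subr0 => Hs.
have := offdiag_ge_linear n.+1 ji (ltW s0) Ks; rewrite -ts => L.
rewrite -lerBlDr; apply: le_trans L.
rewrite [leLHS](_ : _ = t * (Q i j - e) * (1 - K * t)); last by ring.
rewrite ler_wpM2r ?(ltW Kt)// {1}ts (mulrC s) -mulrA ler_wpM2l// mulrC; lra.
Qed.

Definition short_time_error t i j : R := `|p t i j - (i == j)%:R - t * Q i j|.

(** The lower bounds for the diagonal and for the jumps leave, because the rows
    of [p t] sum to at most 1 and those of [Q] to 0, only a mass of order
    [t ^+ 2] to be distributed. *)
Lemma short_time_error_sum t i : 0 <= t ->
  (\sum_(0 <= j <oo) (short_time_error t i j)%:E <= (3 * K ^+ 2 * t ^+ 2)%:E)%E.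
Proof.
move=> t0; have K0 := exit_bound_ge0.
have p0 j : 0 <= p t i j := tf_ge0 tf i j t0.
have pE0 j : (0 <= (p t i j)%:E)%E by rewrite lee_fin.
have eE0 j : (0 <= (short_time_error t i j)%:E)%E by rewrite lee_fin; exact: normr_ge0.
have QE0 j : j != i -> (0 <= (Q i j)%:E)%E.
  by move=> ?; rewrite lee_fin (bc_offdiag_ge0 bc).
have t2 : 0 <= t ^+ 2 := sqr_ge0 t.
have := tf_le1 tf i t0.
rewrite (nneseriesD1 (n := i))//.
rewrite (nneseriesD1 (n := i) (f := fun j => (short_time_error t i j)%:E))//=.
set S := (\sum_(0 <= j <oo | j != i) (p t i j)%:E)%E.
set E := (\sum_(0 <= j <oo | j != i) _)%E.
have S0 : (0 <= S)%E by apply: nneseries_ge0.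
have E0 : (0 <= E)%E by apply: nneseries_ge0.
set q := - Q i i.
have q0 : 0 <= q := exit_rate_ge0 i.
have qK : q <= K := bc_exit_le bc i.
have HE : (E + (t * q)%:E <= S + (2 * K * t ^+ 2 * q)%:E)%E.
  rewrite 2![(_ * q)%:E]EFinM -(bc_row bc i).
  rewrite -!nneseriesZl// -!nneseriesD//;
    try by move=> j _ ji; apply: mule_ge0; [rewrite lee_fin ?mulr_ge0|exact: QE0].
  apply: lee_nneseries => [j _ ji|j ji].
    by rewrite adde_ge0// mule_ge0 ?QE0.
  rewrite -!EFinM -!EFinD lee_fin /short_time_error eq_sym (negPf ji) subr0.
  have := offdiag_ge ji t0; have := bc_offdiag_ge0 bc ji => Qj.
  have : 0 <= K * t * (t * Q i j) by rewrite !mulr_ge0.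
  by case: (ger0P (p t i j - t * Q i j)) => _; lra.
have HS : ((t * q)%:E <= S + (K * t ^+ 2 * q)%:E)%E.
  rewrite 2![(_ * q)%:E]EFinM -(bc_row bc i).
  rewrite -!nneseriesZl// -!nneseriesD//; last first.
    by move=> j _ ji; apply: mule_ge0; [rewrite lee_fin ?mulr_ge0|exact: QE0].
  apply: lee_nneseries => [j _ ji|j ji].
    by rewrite mule_ge0 ?QE0.
  rewrite -!EFinM -!EFinD lee_fin.
  have := offdiag_ge ji t0; lra.
have := diag_ge i t0; rewrite -[Q i i]opprK -/q => Hd.
move=> HpS.
have Sfin : S \is a fin_num.
  rewrite ge0_fin_numE//; apply: le_lt_trans (ltry 1).
  by apply: le_trans HpS; rewrite leeDr// lee_fin.
have Efin : E \is a fin_num.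
  rewrite ge0_fin_numE//.
  apply: le_lt_trans (_ : (S + (2 * K * t ^+ 2 * q)%:E < +oo)%E).
    by apply: le_trans HE; rewrite leeDl// lee_fin mulr_ge0.
  by rewrite -(fineK Sfin) ltry.
move: HpS HE HS; rewrite -(fineK Sfin) -(fineK Efin) -!EFinD !lee_fin.
rewrite /short_time_error eqxx -/q.
have -> : Q i i = - q by rewrite /q opprK.
move: (fine S) (fine E) (p t i i) Hd => s e u.
have : K * t ^+ 2 * q <= K ^+ 2 * t ^+ 2.
  by rewrite expr2 mulrAC ler_wpM2r// ler_wpM2l.
by rewrite mulr1n; case: (ger0P (u - 1 - t * - q)) => _; lra.
Qed.

End ShortTime.

(** * Series of nonnegative terms *)

Section Series.
Variable R : realType.
Implicit Types (f : nat -> \bar R) (n m : nat).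
Local Open Scope ereal_scope.

Lemma eseries_lower f n :
  \sum_(0 <= j <oo) (if (n <= j)%N then f j else 0) = \sum_(n <= j <oo) f j.
Proof.
by rewrite [RHS]eseries_cond [RHS]eseries_mkcond.
Qed.

Lemma nneseries_upper f n : (forall j, 0 <= f j) ->
  \sum_(0 <= j <oo) (if (j < n)%N then f j else 0) = \sum_(0 <= j < n) f j.
Proof.
move=> f0; rewrite (nneseries_split 0 n) ?add0n; last by move=> k _; case: ifP.
rewrite eseries0 ?adde0; last by move=> k kn _; rewrite ltnNge kn.
by apply: eq_big_nat => k /andP[_ ->].
Qed.

Lemma nneseries_between f m n : (forall j, 0 <= f j) ->
  \sum_(0 <= j <oo) (if (m <= j < n)%N then f j else 0) = \sum_(m <= j < n) f j.
Proof.
move=> f0; rewrite (eq_eseriesr (g := fun j =>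
  if (j < n)%N then (if (m <= j)%N then f j else 0) else 0)); last first.
  by move=> j _; rewrite andbC; case: (j < n)%N.
rewrite nneseries_upper; last by move=> j; case: ifP.
rewrite -big_mkcond/= [RHS]big_nat_cond [LHS]big_nat_cond.
have [mn|nm] := leqP m n; last first.
  rewrite !big1_seq// => j /andP[]; rewrite ?mem_index_iota; lia.
rewrite -big_nat_cond (big_cat_nat (n := m))//=.
rewrite [X in X + _]big1_seq ?add0e; last first.
  by move=> j /andP[]; rewrite mem_index_iota; lia.
rewrite -[RHS]big_nat_cond big_nat_cond [RHS]big_nat_cond.
by apply: eq_bigl => j; lia.
Qed.

Lemma eq_eseries_from f g n : (forall j, (n <= j)%N -> f j = g j) ->
  \sum_(n <= j <oo) f j = \sum_(n <= j <oo) g j.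
Proof.
move=> fg; rewrite eseries_cond [RHS]eseries_cond.
by apply: eq_eseriesr => j /= /fg.
Qed.

Lemma le_nneseries_from f g n : (forall j, (n <= j)%N -> 0 <= f j) ->
  (forall j, (n <= j)%N -> f j <= g j) ->
  \sum_(n <= j <oo) f j <= \sum_(n <= j <oo) g j.
Proof.
move=> f0 fg; rewrite eseries_cond [leRHS]eseries_cond.
by apply: lee_nneseries => [j _ /= /f0|j /= /fg].
Qed.

Lemma nneseriesZl_from f (x : R) n : (forall j, (n <= j)%N -> 0 <= f j) ->
  \sum_(n <= j <oo) (x%:E * f j) = x%:E * \sum_(n <= j <oo) f j.
Proof.
move=> f0; rewrite eseries_cond [in RHS]eseries_cond.
by apply: nneseriesZl => j /= /f0.
Qed.

Lemma nneseries_from1 f : (forall j, 0 <= f j) ->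
  \sum_(0 <= j <oo) f j.+1 = \sum_(1 <= j <oo) f j.
Proof.
by move=> f0; rewrite -[RHS]nneseries_addn//; apply: eq_eseriesr => j _; rewrite addn1.
Qed.

End Series.

(** * Balance equations of an equilibrium distribution *)

Section Equilibrium.
Variables (R : realType) (p : R -> nat -> nat -> R) (Q : nat -> nat -> R) (K : R).
Variable pi : nat -> R.
Hypotheses (tf : transition_function p) (pQ : has_qmatrix p Q).
Hypothesis bc : bounded_conservative K Q.
Hypothesis skip_free : forall i j, (j.+1 < i)%N -> Q i j = 0.
Hypothesis eqd : equilibrium_distribution p pi.

Lemma stationary_low_set t n : 0 <= t ->
  (\sum_(0 <= i <oo) (pi i * \sum_(j < n.+1) p t i j)%:E
   = (\sum_(j < n.+1) pi j)%:E)%E.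
Proof.
move=> t0.
under eq_eseriesr do rewrite mulr_sumr -sumEFin.
rewrite nneseries_sum//; last first.
  by move=> j i _; rewrite lee_fin mulr_ge0 ?(eq_ge0 eqd) ?(tf_ge0 tf).
by rewrite -sumEFin; apply: eq_bigr => j _; rewrite (eq_stationary eqd).
Qed.

Lemma low_set_short_time t i n : 0 <= t ->
  `|\sum_(j < n.+1) p t i j
    - ((i < n.+1)%:R + t * \sum_(j < n.+1) Q i j)| <= 3 * K ^+ 2 * t ^+ 2.
Proof.
move=> t0.
have -> : (i < n.+1)%:R = \sum_(j < n.+1) (i == j)%:R :> R.
  have [iln|nil] := ltnP i n.+1.
    rewrite (bigD1 (Ordinal iln))//= eqxx big1 ?addr0// => j ji.
    case: eqP => // ij; case/eqP: ji; exact: val_inj.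
  by rewrite big1// => j _; case: eqP => // ij; have := ltn_ord j; lia.
rewrite mulr_sumr -big_split/= -sumrB.
apply: le_trans (ler_norm_sum _ _ _) _.
rewrite -lee_fin; apply: le_trans (short_time_error_sum tf pQ bc i t0).
rewrite -sumEFin -(big_mkord xpredT
  (fun j => (`|p t i j - ((i == j)%:R + t * Q i j)|)%:E)).
under eq_bigr do rewrite opprD addrA.
by apply: nneseries_lim_ge => j _ _; rewrite lee_fin normr_ge0.
Qed.

(** In equilibrium the probability of [{0, ..., n}] is constant, so its
    derivative at time 0 vanishes.  Only the states up to [n.+1] contribute,
    since downward jumps have size 1. *)
Lemma low_set_balance n :
  \sum_(i < n.+2) pi i * \sum_(j < n.+1) Q i j = 0.
Proof.
set X := LHS; apply/eqP; rewrite -normr_le0.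
(* [3 * K ^+ 2 * t ^+ 2] for the states up to [n.+1], as much for the others *)
pose C := 6 * K ^+ 2.
have C0 : 0 <= C by rewrite mulr_ge0 ?sqr_ge0.
apply: (ler_vanishing_error C0) => t tp; have t0 := ltW tp.
rewrite add0r -(ler_pM2l tp).
have -> : t * (C * t) = 6 * K ^+ 2 * t ^+ 2 by rewrite /C; ring.
rewrite -[X in X * `|_|](gtr0_norm tp) -normrM.
pose a i := \sum_(j < n.+1) p t i j.
pose eps := 3 * K ^+ 2 * t ^+ 2.
have pi0 := eq_ge0 eqd.
have a0 i : 0 <= a i by apply: sumr_ge0 => j _; apply: (tf_ge0 tf).
have eps0 : 0 <= eps by rewrite mulr_ge0 ?sqr_ge0// mulr_ge0 ?sqr_ge0.
have aE i : `|a i - ((i < n.+1)%:R + t * \sum_(j < n.+1) Q i j)| <= eps.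
  exact: low_set_short_time.
have : (\sum_(0 <= i <oo) (pi i * a i)%:E = (\sum_(j < n.+1) pi j)%:E)%E.
  exact: stationary_low_set.
rewrite (nneseries_split 0 n.+2) ?add0n; last first.
  by move=> k _; rewrite lee_fin mulr_ge0.
set T := (\sum_(n.+2 <= i <oo) _)%E.
have T0 : (0 <= T)%E by apply: nneseries_ge0 => k _ _; rewrite lee_fin mulr_ge0.
have pi1 := eq_sum1 eqd; rewrite (nneseries_split 0 n.+2) ?add0n in pi1; last first.
  by move=> k _; rewrite lee_fin.
rewrite !big_mkord !sumEFin in pi1 *.
set PT := (\sum_(n.+2 <= i <oo) _)%E in pi1.
have PT0 : (0 <= PT)%E by apply: nneseries_ge0 => k _ _; rewrite lee_fin.
have TPT : (T <= eps%:E * PT)%E.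
  rewrite -nneseriesZl; last by move=> k _; rewrite lee_fin.
  rewrite /T eseries_cond [leRHS]eseries_cond.
  apply: lee_nneseries => [k _ _|k /= kn].
    by rewrite lee_fin mulr_ge0.
  rewrite -EFinM lee_fin mulrC ler_wpM2r//.
  have := aE k; rewrite big1 ?mulr0 ?addr0; last first.
    by move=> j _; apply: skip_free; have := ltn_ord j; lia.
  rewrite ltnNge (ltnW kn) /= subr0.
  by rewrite ger0_norm.
have PTfin : PT \is a fin_num.
  rewrite ge0_fin_numE//; apply: le_lt_trans (ltry 1).
  by rewrite -pi1 leeDr// lee_fin sumr_ge0.
have Tfin : T \is a fin_num.
  rewrite ge0_fin_numE//; apply: le_lt_trans TPT _.
  by rewrite -(fineK PTfin) -EFinM ltry.
move: pi1 TPT T0; rewrite -(fineK PTfin) -(fineK Tfin) -!EFinD -EFinM !lee_fin.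
move: (fine T) (fine PT) => x y [] pi1 TPT T0 [] sE.
have : `|\sum_(i < n.+2) pi i * a i - (\sum_(j < n.+1) pi j + t * X)|
   <= eps * \sum_(i < n.+2) pi i.
  have -> : \sum_(j < n.+1) pi j = \sum_(i < n.+2) pi i * (i < n.+1)%:R.
    rewrite [RHS]big_ord_recr/= ltnn mulr0 addr0.
    by apply: eq_bigr => j _; rewrite ltn_ord mulr1.
  rewrite mulr_sumr -big_split/= -sumrB mulr_sumr.
  apply: le_trans (ler_norm_sum _ _ _) _; apply: ler_sum => i _.
  rewrite mulrCA -mulrDr -mulrBr normrM ger0_norm// mulrC ler_wpM2r//.
have : eps * \sum_(i < n.+2) pi i + eps * y = eps by rewrite -mulrDr pi1 mulr1.
have -> : 6 * K ^+ 2 * t ^+ 2 = 2 * eps by rewrite /eps; ring.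
rewrite !ler_norml; lra.
Qed.

End Equilibrium.

Section CutEquations.
Variables (R : realType) (p : R -> nat -> nat -> R) (Q : nat -> nat -> R) (K : R).
Variable pi : nat -> R.
Hypotheses (tf : transition_function p) (pQ : has_qmatrix p Q).
Hypothesis bc : bounded_conservative K Q.
Hypothesis skip_free : forall i j, (j.+1 < i)%N -> Q i j = 0.
Hypothesis eqd : equilibrium_distribution p pi.

Lemma row_tail i n : (i <= n)%N ->
  (\sum_(n.+1 <= j <oo) (Q i j)%:E = (- \sum_(j < n.+1) Q i j)%:E)%E.
Proof.
move=> iln; have := bc_row bc i.
rewrite (nneseries_split_cond 0 n.+1) ?add0n; last first.
  by move=> k ki; rewrite lee_fin (bc_offdiag_ge0 bc).
have -> : (\sum_(n.+1 <= k <oo | k != i) (Q i k)%:E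
    = \sum_(n.+1 <= k <oo) (Q i k)%:E)%E.
  rewrite eseries_cond [RHS]eseries_cond; apply: eq_eseriesl => k /=.
  by case: ltnP => //; lia.
have -> : \sum_(j < n.+1) Q i j = Q i i + \sum_(j < n.+1 | j != i :> nat) Q i j.
  by rewrite (bigD1 (Ordinal (iln : (i < n.+1)%N)))//=.
rewrite big_mkord sumEFin.
case: (\sum_(n.+1 <= k <oo) _)%E => // r [] H; congr EFin.
by rewrite -(subKr (- Q i i) r) -[in X in _ - X]H; ring.
Qed.

(** A rewriting of [low_set_balance]: the rows [i <= n] of [Q] have sum 0, and
    [n.+1] is the only outer state with a jump into the set. *)
Lemma cut_balance n :
  (\sum_(i < n.+1) (pi i)%:E * \sum_(n.+1 <= j <oo) (Q i j)%:E
   = (pi n.+1 * Q n.+1 n)%:E)%E.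
Proof.
have := low_set_balance tf pQ bc skip_free eqd n.
rewrite big_ord_recr/= [X in _ + pi _ * X]big_ord_recr/=.
rewrite [X in X + Q _ _]big1 ?add0r; last first.
  by move=> j _; apply: skip_free; have := ltn_ord j; lia.
move=> /eqP; rewrite addrC addr_eq0 => /eqP ->.
rewrite -sumrN -sumEFin; apply: eq_bigr => i _.
by rewrite (row_tail (ltn_ord i : (i <= n)%N)) -EFinM mulrN.
Qed.

Definition upward (i j : nat) : R := if (i < j)%N then Q i j else 0.

Lemma upward_ge0 i j : 0 <= upward i j.
Proof.
rewrite /upward; case: ltnP => // ij; apply: (bc_offdiag_ge0 bc); lia.
Qed.

(** Summing the cut equations with weights [w n] amounts to computing the mean
    drift of the test function [f k = w 0 + ... + w k.-1]: an upward jump from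
    [i] to [j] crosses the cuts [n] with [i <= n < j], so it raises [f] by the
    inner sum, and a downward jump from [n.+1] lowers [f] by [w n]. *)
Lemma drift_balance (w : nat -> R) : (forall n, 0 <= w n) ->
  (\sum_(0 <= n <oo) (w n * (pi n.+1 * Q n.+1 n))%:E
   = \sum_(0 <= i <oo) (pi i)%:E *
       \sum_(0 <= j <oo) (upward i j * \sum_(i <= n < j) w n)%:E)%E.
Proof.
move=> w0; have pi0 := eq_ge0 eqd.
pose a n i j : R := if (i <= n < j)%N then w n * pi i * Q i j else 0.
have a0 n i j : (0 <= (a n i j)%:E)%E.
  rewrite lee_fin /a; case: ifP => // /andP[ia ja].
  rewrite mulr_ge0 ?mulr_ge0//; apply: (bc_offdiag_ge0 bc); lia.
transitivity (\sum_(0 <= n <oo) \sum_(0 <= i <oo) \sum_(0 <= j <oo) (a n i j)%:E)%E.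
  apply: eq_eseriesr => n _.
  pose f i := ((w n)%:E * ((pi i)%:E *
    \sum_(0 <= j <oo) (if (n < j)%N then (upward i j)%:E else 0)))%E.
  have s0 i : (0 <= \sum_(0 <= j <oo) (if (n < j)%N then (upward i j)%:E else 0))%E.
    by apply: nneseries_ge0 => j _ _; case: ifP => // _; rewrite lee_fin upward_ge0.
  have f0 i : (0 <= f i)%E by rewrite mule_ge0 ?mule_ge0 ?lee_fin ?s0.
  transitivity (\sum_(0 <= i < n.+1) f i)%E.
    rewrite big_mkord -ge0_sume_distrr; last first.
      by move=> i _; rewrite mule_ge0 ?lee_fin ?s0.
    rewrite EFinM -cut_balance; congr (_ * _)%E.
    apply: eq_bigr => i _; congr (_ * _)%E; rewrite -eseries_lower.
    apply: eq_eseriesr => j _; case: ltnP => // nj; rewrite /upward.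
    by rewrite (leq_ltn_trans _ nj)// -ltnS.
  rewrite -nneseries_upper//; apply: eq_eseriesr => i _.
  rewrite ltnS; case: leqP => iln; last first.
    by rewrite eseries0// => j _ _; rewrite /a leqNgt iln.
  rewrite /f muleA -EFinM -nneseriesZl; last first.
    by move=> j _; case: ifP => // _; rewrite lee_fin upward_ge0.
  apply: eq_eseriesr => j _; rewrite /a iln/=; case: ltnP => nj; last by rewrite mule0.
  by rewrite /upward (leq_ltn_trans iln nj).
rewrite nneseries_interchange; last by move=> n i; apply: nneseries_ge0 => j _ _.
apply: eq_eseriesr => i _.
rewrite nneseries_interchange// -nneseriesZl; last first.
  move=> j _; rewrite lee_fin mulr_ge0 ?upward_ge0// sumr_ge0//.
apply: eq_eseriesr => j _.
rewrite -EFinM.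
have [ij|ji] := ltnP i j; last first.
  rewrite /upward ltnNge ji mul0r mulr0 eseries0// => n _ _.
  by rewrite /a; case: ifP => //; lia.
rewrite (_ : pi i * _ = \sum_(i <= n < j) w n * pi i * Q i j); last first.
  rewrite /upward ij mulr_sumr mulr_sumr; apply: eq_bigr => n _; ring.
rewrite -sumEFin -nneseries_between; last first.
  move=> n; rewrite lee_fin mulr_ge0 ?mulr_ge0//; apply: (bc_offdiag_ge0 bc); lia.
by apply: eq_eseriesr => n _; rewrite /a; case: ifP.
Qed.

End CutEquations.

(** * Functions with increments known to second order *)

Section SecondOrderIncrements.
Variables (R : realType) (F f : R -> R) (C L : R).
Hypothesis C_ge0 : 0 <= C.
Hypothesis L_ge0 : 0 <= L.
Hypothesis F_incr : forall T t, 0 <= T -> 0 <= t ->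
  `|F (T + t) - F T + t * f T| <= C * t ^+ 2.
Hypothesis f_lip : forall T t, 0 <= T -> 0 <= t -> `|f (T + t) - f T| <= L * t.
Hypothesis f_ge0 : forall T, 0 <= T -> 0 <= f T.

Lemma lipschitz_within : {within `[0, +oo[, continuous f}.
Proof.
apply/continuous_within_itvcyP; split.
  move=> x; rewrite in_itv/= andbT => x0.
  apply/cvgrPdist_le => e e0.
  near=> y.
  have y0 : 0 < y by near: y; apply: lt_nbhsr.
  have : (L + 1) * `|x - y| <= e.
    rewrite -ler_pdivlMl ?ltr_wpDl//.
    near: y; apply: (@cvgr_dist_le _ _ _ _ _ id) => //.
    by rewrite mulr_gt0// invr_gt0 ltr_wpDl.
  have H u v : 0 < u -> 0 < v -> u <= v -> `|f v - f u| <= L * (v - u).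
    move=> u0 v0 uv; have := @f_lip u (v - u) (ltW u0).
    by rewrite subrKC subr_ge0 => /(_ uv).
  apply: le_trans; rewrite mulrDl mul1r -[leLHS]addr0 lerD//.
  have [xy|yx] := leP x y; last first.
    by rewrite (ger0_norm (_ : 0 <= x - y)) ?subr_ge0 ?H ?(ltW yx).
  by rewrite distrC (distrC x) (ger0_norm (_ : 0 <= y - x)) ?subr_ge0 ?H.
apply/cvgrPdist_le => e e0.
near=> y.
have y0 : 0 < y by near: y; apply: nbhs_right_gt.
have : y <= e / (L + 1).
  by near: y; apply: nbhs_right_le; rewrite divr_gt0// ltr_wpDl.
rewrite ler_pdivlMr ?ltr_wpDl//.
have := @f_lip 0 y (lexx _) (ltW y0); rewrite add0r distrC; nra.
Unshelve. all: by end_near.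
Qed.

(** For [h < 0] the hypothesis applies from [x + h], where [f] differs from
    [f x] by at most [L * `|h|]. *)
Lemma increments_two_sided x h : 0 < x -> - x < h ->
  `|F (h + x) - F x + h * f x| <= (C + L) * h ^+ 2.
Proof.
move=> x0 xh; have [h0|h0] := leP 0 h.
  have := F_incr (ltW x0) h0; rewrite (addrC x).
  by have := mulr_ge0 L_ge0 (sqr_ge0 h); lra.
have xh0 : 0 <= x + h by lra.
have nh0 : 0 <= - h by lra.
have := F_incr xh0 nh0; have := f_lip xh0 nh0.
rewrite addrK (addrC x) sqrrN.
rewrite (_ : F (h + x) - F x + h * f x
  = - (F x - F (h + x) + - h * f (h + x)) + h * (f x - f (h + x))); last by ring.
move=> A B; apply: le_trans (ler_normD _ _) _.
rewrite normrN normrM (ltr0_norm h0).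
have : - h * `|f x - f (h + x)| <= - h * (L * - h) by rewrite ler_wpM2l.
lra.
Qed.

Lemma derivative_of_increments x : 0 < x ->
  h^-1 *: (- F (h + x) - - F x) @[h --> 0^'] --> f x.
Proof.
move=> x0; apply/subr_cvg0; apply: (cvg_to_0_linear (K := C + L) x0) => h /andP[h0 hx].
have hn0 : h != 0 by rewrite -normr_gt0.
have xh : - x < h by move: hx; rewrite ltr_norml => /andP[].
rewrite -(ler_pM2l h0) -normrM mulrCA -expr2 real_normK ?num_real//.
apply: le_trans (increments_two_sided x0 xh).
rewrite /GRing.scale/= mulrBr mulVKf// -normrN le_eqVlt; apply/orP; left.
by apply/eqP; congr (`|_|); ring.
Qed.

(** The fundamental theorem of calculus for [- F], whose derivative is [f]. *)
Lemma integral_of_decrease : F x @[x --> +oo] --> 0 ->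
  (\int[lebesgue_measure]_(x in `[0%R, +oo[) (f x)%:E = (F 0)%:E)%E.
Proof.
move=> F0.
rewrite (@ge0_continuous_FTC2y R f (fun x => - F x) 0 0)//.
- by rewrite -EFinB opprK add0r.
- exact: lipschitz_within.
- by rewrite -oppr0; apply: cvgN.
- move=> x x0; apply/cvg_ex; exists (f x).
  have := derivative_of_increments x0.
  by under eq_fun do rewrite -[X in F (X + x)]mulr1.
- apply: cvgN; apply/cvgrPdist_le => e e0.
  have f00 : 0 <= f 0 by exact: f_ge0.
  have M0 : 0 < C + f 0 + 1 by rewrite ltr_wpDl// addr_ge0.
  near=> y.
  have y0 : 0 < y by near: y; apply: nbhs_right_gt.
  have y1 : y <= 1 by near: y; apply: nbhs_right_le.
  have : y <= e / (C + f 0 + 1).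
    by near: y; apply: nbhs_right_le; rewrite divr_gt0.
  rewrite ler_pdivlMr//.
  have := F_incr (lexx 0) (ltW y0); rewrite add0r (distrC (F 0)) => H ye.
  have : `|F y - F 0| <= `|F y - F 0 + y * f 0| + y * f 0.
    rewrite -{2}(ger0_norm (_ : 0 <= y * f 0)) ?mulr_ge0 ?(ltW y0)//.
    by rewrite -{1}(addrK (y * f 0) (F y - F 0)) ler_normB.
  have : C * y ^+ 2 <= C * y by rewrite ler_wpM2l// expr2 ger_pMl.
  lra.
- move=> x; rewrite in_itv/= andbT => x0; rewrite /derive1.
  by apply: cvg_lim => //; exact: derivative_of_increments.
Unshelve. all: by end_near.
Qed.

End SecondOrderIncrements.

(** * Occupation times of the stopped chain *)

Section Occupation.
Variables (R : realType) (K : R).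
Variables (p pt : R -> nat -> nat -> R) (Q Qt : nat -> nat -> R) (pi : nat -> R).
Hypotheses (tf : transition_function p) (pQ : has_qmatrix p Q).
Hypotheses (tft : transition_function pt) (ptQ : has_qmatrix pt Qt).
Hypotheses (bc : bounded_conservative K Q) (bct : bounded_conservative K Qt).
Hypothesis absorbed : forall j, Q 0%N j = 0.
Hypothesis same_rows : forall i j, i != 0%N -> Q i j = Qt i j.
Hypothesis down_rate_gt0 : forall k, 0 < Q k.+1 k.
Hypothesis eqd : equilibrium_distribution pt pi.
Implicit Types (s t T : R) (i j k l n : nat).

Let p0 t i j : 0 <= t -> 0 <= p t i j. Proof. exact: (tf_ge0 tf). Qed.
Let pE0 t i j : 0 <= t -> (0 <= (p t i j)%:E)%E.
Proof. by move=> t0; rewrite lee_fin p0. Qed.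
Let pi0 k : 0 <= pi k. Proof. exact: (eq_ge0 eqd). Qed.
Let K0 : 0 <= K. Proof. exact: (exit_bound_ge0 bc). Qed.

Lemma absorbing_diag t : 0 <= t -> p t 0%N 0%N = 1.
Proof.
move=> t0; apply/eqP; rewrite eq_le (transition_le1 tf)//=.
by have := diag_ge tf pQ bc 0%N t0; rewrite absorbed mulr0 addr0.
Qed.

Lemma absorbing_offdiag t k : 0 <= t -> (0 < k)%N -> p t 0%N k = 0.
Proof.
move=> t0 k0; apply/eqP; rewrite eq_le p0// andbT.
have := tf_le1 tf 0%N t0.
rewrite (nneseries_split 0 k.+1); last by move=> j _; exact: pE0.
rewrite add0n big_mkord big_ord_recl absorbing_diag//=.
move=> H; rewrite -lee_fin -(@leeD2lE _ 1)// adde0; apply: le_trans H.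
rewrite -addeA leeD2lE//; case: k k0 => // k _.
rewrite big_ord_recr/= addeAC leeDr// adde_ge0//.
  by rewrite sume_ge0// => j _; exact: pE0.
by apply: nneseries_ge0 => j _ _; exact: pE0.
Qed.

(** The chain leaves [j] during the additional time [t] with probability at most
    [K * t]. *)
Lemma transition_lipschitz t T j k : 0 <= t -> 0 <= T ->
  `|p (T + t) j k - p T j k| <= K * t.
Proof.
move=> t0 T0; rewrite (addrC T).
have D := diag_ge_bound tf pQ bc j t0.
have Kt : 0 <= K * t by rewrite mulr_ge0.
have A := transition_ge_via tf j j k t0 T0.
have B0 := p0 j k T0; have B1 := transition_le1 tf j k T0.
have D1 := transition_le1 tf j j t0.
have U : p (t + T) j k <= p t j j * p T j k + (1 - p t j j).
  rewrite -lee_fin (tf_chapman_kolmogorov tf)//.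
  rewrite (nneseriesD1 (n := j))//; last first.
    by move=> l _; rewrite lee_fin mulr_ge0 ?p0.
  rewrite EFinD leeD2lE//.
  apply: (@le_trans _ _ (\sum_(0 <= l <oo | l != j) (p t j l)%:E)%E).
    apply: lee_nneseries => [l _ _|l _].
      by rewrite lee_fin mulr_ge0 ?p0.
    by rewrite lee_fin ler_piMr ?p0 ?(transition_le1 tf).
  have := tf_le1 tf j t0; rewrite (nneseriesD1 (n := j))//; last first.
    by move=> l _; exact: pE0.
  by rewrite EFinB leeBrDl.
rewrite ler_norml; apply/andP; split; nra.
Qed.

(** The law at time [T] of the stopped chain started from the equilibrium [pi]
    of the resurrected one. *)
Definition survival T k : R := fine (\sum_(0 <= i <oo) (pi i * p T i k)%:E)%E.

(** The probability flux into [k] at time [T] per unit of mass restarted from 0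
    at time 0; the factor [(0 < l)%:R] removes the diagonal entry of row 0. *)
Definition restart_flow k T : R :=
  fine (\sum_(0 <= l <oo) ((0 < l)%:R * Qt 0%N l * p T l k)%:E)%E.

Lemma survivalE T k : 0 <= T ->
  (\sum_(0 <= i <oo) (pi i * p T i k)%:E = (survival T k)%:E)%E.
Proof.
move=> T0; rewrite fineK// ge0_fin_numE; last first.
  by apply: nneseries_ge0 => i _ _; rewrite lee_fin mulr_ge0 ?p0.
apply: (@le_lt_trans _ _ 1%E); last exact: ltry.
rewrite -(eq_sum1 eqd); apply: lee_nneseries => [i _ _|i _].
  by rewrite lee_fin mulr_ge0 ?p0.
by rewrite lee_fin ler_piMr ?(transition_le1 tf).
Qed.

Lemma survival_ge0 T k : 0 <= T -> 0 <= survival T k.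
Proof.
move=> T0; rewrite -lee_fin -survivalE//.
by apply: nneseries_ge0 => i _ _; rewrite lee_fin mulr_ge0 ?p0.
Qed.

Lemma survival_le1 T k : 0 <= T -> survival T k <= 1.
Proof.
move=> T0; rewrite -lee_fin -survivalE// -(eq_sum1 eqd).
apply: lee_nneseries => [i _ _|i _].
  by rewrite lee_fin mulr_ge0 ?p0.
by rewrite lee_fin ler_piMr ?(transition_le1 tf).
Qed.

Let q0 l : 0 <= (0 < l)%:R * Qt 0%N l.
Proof.
case: l => [|l]; first by rewrite mul0r.
by rewrite mul1r (bc_offdiag_ge0 bct).
Qed.

Lemma restart_rate_le : (\sum_(0 <= l <oo) ((0 < l)%:R * Qt 0%N l)%:E <= K%:E)%E.
Proof.
apply: le_trans (_ : (- Qt 0%N 0%N)%:E <= _)%E; last first.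
  by rewrite lee_fin (bc_exit_le bct).
rewrite -(bc_row bct) [leRHS]eseries_mkcond; apply: lee_nneseries => [l _ _|l _].
  by rewrite lee_fin.
by case: l => [|l]; rewrite ?mul0r ?mul1r.
Qed.

Lemma restart_flowE T k : 0 <= T ->
  (\sum_(0 <= l <oo) ((0 < l)%:R * Qt 0%N l * p T l k)%:E = (restart_flow k T)%:E)%E.
Proof.
move=> T0; rewrite fineK// ge0_fin_numE; last first.
  by apply: nneseries_ge0 => l _ _; rewrite lee_fin mulr_ge0 ?p0.
apply: (@le_lt_trans _ _ K%:E); last exact: ltry.
apply: le_trans restart_rate_le; apply: lee_nneseries => [l _ _|l _].
  by rewrite lee_fin mulr_ge0 ?p0.
by rewrite lee_fin ler_piMr ?(transition_le1 tf).
Qed.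

Lemma restart_flow_ge0 k T : 0 <= T -> 0 <= restart_flow k T.
Proof.
move=> T0; rewrite -lee_fin -restart_flowE//.
by apply: nneseries_ge0 => l _ _; rewrite lee_fin mulr_ge0 ?p0.
Qed.

Lemma restart_flow_le k s T : 0 <= T -> 0 <= s -> forall e, 0 <= e ->
  (forall l, p s l k <= p T l k + e) -> restart_flow k s <= restart_flow k T + K * e.
Proof.
move=> T0 s0 e e0 H; rewrite -lee_fin EFinD -!restart_flowE//.
apply: (@le_trans _ _ (\sum_(0 <= l <oo) ((0 < l)%:R * Qt 0%N l * p T l k)%:E
    + e%:E * \sum_(0 <= l <oo) ((0 < l)%:R * Qt 0%N l)%:E)%E).
  rewrite -nneseriesZl; last by move=> l _; rewrite lee_fin.
  rewrite -nneseriesD; last 2 first.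
  - by move=> l _ _; rewrite lee_fin mulr_ge0 ?p0.
  - by move=> l _ _; rewrite mule_ge0 ?lee_fin.
  apply: lee_nneseries => [l _ _|l _]; first by rewrite lee_fin mulr_ge0 ?p0.
  rewrite -EFinM -EFinD lee_fin (mulrC e) -mulrDr ler_wpM2l//.
by rewrite leeD2l// mulrC EFinM lee_wpmul2l ?lee_fin ?restart_rate_le.
Qed.

Lemma weighted_series_le (x y z w : nat -> R) :
  (forall l, 0 <= x l) -> (forall l, 0 <= y l) -> (forall l, 0 <= z l) ->
  (forall l, 0 <= w l <= 1) -> (forall l, x l <= y l + z l) ->
  (\sum_(0 <= l <oo) (x l * w l)%:E
   <= \sum_(0 <= l <oo) (y l * w l)%:E + \sum_(0 <= l <oo) (z l)%:E)%E.
Proof.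
move=> x0 y0 z0 w01 xyz; rewrite -nneseriesD; last 2 first.
- by move=> l _ _; have /andP[? _] := w01 l; rewrite lee_fin mulr_ge0.
- by move=> l _ _; rewrite lee_fin.
apply: lee_nneseries => [l _ _|l _]; have /andP[w0 w1] := w01 l.
  by rewrite lee_fin mulr_ge0.
rewrite -EFinD lee_fin; apply: (@le_trans _ _ ((y l + z l) * w l)).
  by rewrite ler_wpM2r.
by rewrite mulrDl lerD2l ler_piMr.
Qed.

(* [3 * K ^+ 2] for each of the two chains *)
Let C := 6 * K ^+ 2.
Let C0 : 0 <= C. Proof. by rewrite mulr_ge0 ?sqr_ge0. Qed.

Let p01 T k l : 0 <= T -> 0 <= p T l k <= 1.
Proof. by move=> T0; rewrite p0// (transition_le1 tf). Qed.
Let pt0 t i j : 0 <= t -> 0 <= pt t i j. Proof. exact: (tf_ge0 tft). Qed.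

(** From a state [i != 0] both chains follow the same rates during [t].  From 0
    the stopped chain stays there, which [k != 0] does not see, while the
    resurrected one reaches [l] with probability close to [t * Qt 0 l]. *)
Lemma restarted_row t T i k : 0 <= t -> 0 <= T -> (0 < k)%N ->
  let A := (p (t + T) i k + (i == 0%N)%:R * (t * restart_flow k T))%:E in
  let A' := (\sum_(0 <= l <oo) (pt t i l * p T l k)%:E)%E in
  ((A <= A' + (C * t ^+ 2)%:E) /\ (A' <= A + (C * t ^+ 2)%:E))%E.
Proof.
move=> t0 T0 k0 A A'.
pose x l := if i == 0%N then t * ((0 < l)%:R * Qt 0%N l) else p t i l.
pose y l := if i == 0%N then (0 < l)%:R * pt t 0%N l else pt t i l.
pose z l := short_time_error p Q t i l + short_time_error pt Qt t i l.
have x0 l : 0 <= x l by rewrite /x; case: ifP => _; rewrite ?p0// mulr_ge0.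
have y0 l : 0 <= y l by rewrite /y; case: ifP => _; rewrite ?mulr_ge0 ?pt0.
have z0 l : 0 <= z l by rewrite addr_ge0 ?normr_ge0.
have xyz l : `|x l - y l| <= z l.
  rewrite /x /y /z; case: eqVneq => [->|i0].
    apply: (@le_trans _ _ (short_time_error pt Qt t 0%N l)); last first.
      by rewrite lerDr normr_ge0.
    case: l => [|l]; first by rewrite !mul0r mulr0 subr0 normr0 normr_ge0.
    by rewrite !mul1r distrC /short_time_error eq_sym/= subr0.
  rewrite /short_time_error same_rows// (_ : p t i l - pt t i l
    = (p t i l - (i == l)%:R - t * Qt i l)
      - (pt t i l - (i == l)%:R - t * Qt i l)); last by ring.
  exact: ler_normB.
have zC : (\sum_(0 <= l <oo) (z l)%:E <= (C * t ^+ 2)%:E)%E.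
  under eq_eseriesr do rewrite EFinD.
  rewrite nneseriesD; last 2 first.
  - by move=> l _ _; rewrite lee_fin normr_ge0.
  - by move=> l _ _; rewrite lee_fin normr_ge0.
  apply: le_trans (leeD (short_time_error_sum tf pQ bc i t0)
    (short_time_error_sum tft ptQ bct i t0)) _.
  by rewrite -EFinD lee_fin /C; lra.
have AE : A = (\sum_(0 <= l <oo) (x l * p T l k)%:E)%E.
  rewrite /A /x; case: eqVneq => [->|i0]; last first.
    by rewrite mul0r addr0 (tf_chapman_kolmogorov tf).
  rewrite absorbing_offdiag ?addr_ge0// add0r mul1r EFinM -restart_flowE//.
  rewrite -nneseriesZl; last by move=> l _; rewrite lee_fin mulr_ge0 ?p0.
  by apply: eq_eseriesr => l _; rewrite -EFinM -[in RHS]mulrA.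
have A'E : A' = (\sum_(0 <= l <oo) (y l * p T l k)%:E)%E.
  rewrite /A' /y; apply: eq_eseriesr => -[|l] _; case: eqVneq => [->|//].
    by rewrite absorbing_offdiag// !mulr0.
  by rewrite mul1r.
have w01 l := p01 k l T0.
rewrite AE A'E; split.
  apply: le_trans (weighted_series_le x0 y0 z0 w01 _) _; last exact: leeD2l.
  by move=> l; rewrite -lerBlDl (le_trans (ler_norm _)).
apply: le_trans (weighted_series_le y0 x0 z0 w01 _) _; last exact: leeD2l.
by move=> l; rewrite -lerBlDl (le_trans (ler_norm _))// distrC.
Qed.

Lemma equilibrium_then_killed t T k : 0 <= t -> 0 <= T ->
  (\sum_(0 <= i <oo) (pi i)%:E * \sum_(0 <= l <oo) (pt t i l * p T l k)%:E
   = (survival T k)%:E)%E.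
Proof.
move=> t0 T0; rewrite -survivalE//.
transitivity (\sum_(0 <= i <oo) \sum_(0 <= l <oo) (pi i * (pt t i l * p T l k))%:E)%E.
  apply: eq_eseriesr => i _; rewrite -nneseriesZl//.
  by move=> l _; rewrite lee_fin mulr_ge0 ?p0 ?pt0.
rewrite nneseries_interchange; last first.
  by move=> i l; rewrite lee_fin !mulr_ge0 ?p0 ?pt0.
apply: eq_eseriesr => l _.
rewrite mulrC EFinM -(eq_stationary eqd l t0) -nneseriesZl; last first.
  by move=> i _; rewrite lee_fin mulr_ge0 ?pt0.
by apply: eq_eseriesr => i _; rewrite -EFinM; congr EFin; ring.
Qed.

Lemma average_cst x : (\sum_(0 <= i <oo) (pi i * x)%:E = x%:E)%E.
Proof.
under eq_eseriesr do rewrite mulrC EFinM.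
by rewrite nneseriesZl ?(eq_sum1 eqd) ?mule1// => i _; rewrite lee_fin.
Qed.

Lemma average_at0 x : 0 <= x ->
  (\sum_(0 <= i <oo) (pi i * ((i == 0%N)%:R * x))%:E = (pi 0%N * x)%:E)%E.
Proof.
move=> x0; rewrite (nneseriesD1 (n := 0%N))//; last first.
  by move=> i _; rewrite lee_fin !mulr_ge0.
rewrite mul1r eseries0 ?adde0// => i _ /andP[_ i0].
by rewrite (negPf i0) mul0r mulr0.
Qed.

(** Running the stopped queue instead of the resurrected one for a short time
    [t] from equilibrium changes the distribution only by the mass
    [t * pi 0 * Qt 0 l] that the restarts would have sent to the states [l]. *)
Lemma survival_increment k T t : (0 < k)%N -> 0 <= T -> 0 <= t ->
  `|survival (T + t) k - survival T k + t * (pi 0%N * restart_flow k T)|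
  <= C * t ^+ 2.
Proof.
move=> k0 T0 t0; rewrite (addrC T).
have g0 := restart_flow_ge0 k T0.
have Ct : 0 <= C * t ^+ 2 by rewrite mulr_ge0 ?sqr_ge0.
have tT : 0 <= t + T by rewrite addr_ge0.
have L : (\sum_(0 <= i <oo) (pi i)%:E *
      (p (t + T) i k + (i == 0%N)%:R * (t * restart_flow k T))%:E
    = (survival (t + T) k + pi 0%N * (t * restart_flow k T))%:E)%E.
  under eq_eseriesr do rewrite -EFinM mulrDr EFinD.
  rewrite nneseriesD ?survivalE ?average_at0 ?EFinD// ?mulr_ge0//.
    by move=> i _ _; rewrite lee_fin mulr_ge0 ?p0.
  by move=> i _ _; rewrite lee_fin !mulr_ge0.
have B0 i : (0 <= \sum_(0 <= l <oo) (pt t i l * p T l k)%:E)%E.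
  by apply: nneseries_ge0 => l _ _; rewrite lee_fin mulr_ge0 ?p0 ?pt0.
have U : survival (t + T) k + pi 0%N * (t * restart_flow k T)
    <= survival T k + C * t ^+ 2.
  rewrite -lee_fin -L EFinD -(equilibrium_then_killed k t0 T0) -[(C * _)%:E]average_cst.
  rewrite -nneseriesD; last 2 first.
  - by move=> i _ _; rewrite mule_ge0 ?lee_fin.
  - by move=> i _ _; rewrite lee_fin mulr_ge0.
  apply: lee_nneseries => [i _ _|i _].
    by rewrite mule_ge0 ?lee_fin// addr_ge0 ?p0 ?mulr_ge0.
  rewrite [(pi i * _)%:E]EFinM -ge0_muleDr ?lee_fin//.
  by rewrite lee_wpmul2l ?lee_fin//; have [] := restarted_row i t0 T0 k0.
have V : survival T k
    <= survival (t + T) k + pi 0%N * (t * restart_flow k T) + C * t ^+ 2.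
  rewrite -lee_fin EFinD -L -(equilibrium_then_killed k t0 T0) -[(C * _)%:E]average_cst.
  rewrite -nneseriesD; last 2 first.
  - by move=> i _ _; rewrite mule_ge0 ?lee_fin// addr_ge0 ?p0 ?mulr_ge0.
  - by move=> i _ _; rewrite lee_fin mulr_ge0.
  apply: lee_nneseries => [i _ _|i _]; first by rewrite mule_ge0 ?lee_fin.
  rewrite [(pi i * (C * _))%:E]EFinM -ge0_muleDr ?lee_fin ?addr_ge0 ?p0 ?mulr_ge0//.
  by rewrite lee_wpmul2l ?lee_fin//; have [] := restarted_row i t0 T0 k0.
rewrite ler_norml; apply/andP; split; lra.
Qed.

(** Over [n] steps of length [t / n] the quadratic errors add up to
    [C * t ^+ 2 / n]. *)
Lemma survival_nincr k T t : (0 < k)%N -> 0 <= T -> 0 <= t ->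
  survival (T + t) k <= survival T k.
Proof.
move=> k0 T0 t0.
have step n s : 0 <= s ->
    survival (T + n%:R * s) k <= survival T k + n%:R * (C * s ^+ 2).
  move=> s0; elim: n => [|n IH]; first by rewrite !mul0r !addr0.
  have Tn : 0 <= T + n%:R * s by rewrite addr_ge0 ?mulr_ge0.
  have := survival_increment k0 Tn s0.
  have : 0 <= s * (pi 0%N * restart_flow k (T + n%:R * s)).
    by rewrite !mulr_ge0 ?restart_flow_ge0.
  rewrite -natr1 !mulrDl !mul1r [T + (_ + _)]addrA.
  by rewrite ler_norml => h /andP[_]; lra.
apply: (@ler_vanishing_error _ _ _ (C * t)); first by rewrite mulr_ge0.
move=> e e0; have [n nt] := archimedean_step e0 t0.
have n0 : n.+1%:R != 0 :> R by [].
have := step n.+1 (t / n.+1%:R) (divr_ge0 t0 (ler0n _ _)).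
rewrite mulrCA divff// mulr1 => H; apply: le_trans H _.
rewrite lerD2l.
have -> : n.+1%:R * (C * (t / n.+1%:R) ^+ 2) = C * t * (t / n.+1%:R) by field.
by rewrite ler_wpM2l ?mulr_ge0// ltW.
Qed.

Lemma survival_ge_via t T i j : 0 <= t -> 0 <= T ->
  survival T i * p t i j <= survival (T + t) j.
Proof.
move=> t0 T0; rewrite -lee_fin EFinM muleC -!survivalE ?addr_ge0//.
rewrite -nneseriesZl; last by move=> l _; rewrite lee_fin mulr_ge0 ?p0.
apply: lee_nneseries => [l _ _|l _]; first by rewrite mule_ge0 ?lee_fin ?mulr_ge0 ?p0.
rewrite -EFinM lee_fin mulrC -mulrA ler_wpM2l//.
exact: (transition_ge_via tf).
Qed.

Lemma survival0_ge t T : 0 <= t -> 0 <= T ->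
  survival T 0 + survival T 1 * p t 1%N 0%N <= survival (T + t) 0.
Proof.
move=> t0 T0; rewrite -lee_fin EFinD EFinM muleC -!survivalE ?addr_ge0//.
rewrite -nneseriesZl; last by move=> l _; rewrite lee_fin mulr_ge0 ?p0.
rewrite -nneseriesD; last 2 first.
- by move=> l _ _; rewrite lee_fin mulr_ge0 ?p0.
- by move=> l _ _; rewrite mule_ge0 ?lee_fin ?mulr_ge0 ?p0.
apply: lee_nneseries => [l _ _|l _].
  by rewrite adde_ge0 ?mule_ge0 ?lee_fin ?mulr_ge0 ?p0.
rewrite -EFinM -EFinD lee_fin mulrCA -mulrDr ler_wpM2l//.
have := @transition_ge_via2 _ _ tf T t l 0 1 0 T0 t0 isT.
by rewrite absorbing_diag// mulr1 (mulrC (p t _ _)).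
Qed.

Lemma down_probability_gt0 k : exists2 t, 0 <= t & 0 < p t k.+1 k.
Proof.
have kk : k != k.+1 by rewrite neq_ltn ltnS leqnn.
have Kp : 0 < K.
  apply: lt_le_trans (down_rate_gt0 k) _.
  exact: le_trans (rate_le_exit bc kk) (bc_exit_le bc _).
have t0 : 0 <= (2 * K)^-1 by rewrite invr_ge0 mulr_ge0.
(* half the time up to which the lower bound of [offdiag_ge] is positive *)
exists (2 * K)^-1 => //; apply: lt_le_trans (offdiag_ge tf pQ bc kk t0).
have -> : 1 - K * (2 * K)^-1 = 2^-1 by field; rewrite gt_eqF.
by rewrite !mulr_gt0 ?invr_gt0 ?mulr_gt0.
Qed.

(** Whatever remains in state 1 keeps feeding the absorbing state 0, whose
    mass is at most 1; and state [k.+1] feeds state [k]. *)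
Lemma survival_small k e : (0 < k)%N -> 0 < e ->
  exists2 T, 0 <= T & survival T k <= e.
Proof.
case: k => // k _; elim: k e => [|k IH] e e0.
  have [t t0 pt1] := down_probability_gt0 0.
  have c0 : 0 < e * p t 1%N 0%N by rewrite mulr_gt0.
  have [n nc] := archimedean_step c0 ler01.
  apply: contrapT => H.
  have S T : 0 <= T -> e < survival T 1.
    by move=> T0; rewrite ltNge; apply/negP => ?; apply: H; exists T.
  have G m : m%:R * (e * p t 1%N 0%N) <= survival (m%:R * t) 0.
    elim: m => [|m IH]; first by rewrite mul0r survival_ge0 ?mul0r.
    have m0 : 0 <= m%:R * t by rewrite mulr_ge0.
    rewrite -natr1 !mulrDl !mul1r; apply: le_trans (survival0_ge t0 m0).
    by rewrite lerD// ler_wpM2r ?(ltW pt1) ?(ltW (S _ _)).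
  have := G n.+1; apply/negP; rewrite -ltNge.
  apply: le_lt_trans (survival_le1 _ _) _; first by rewrite mulr_ge0.
  by move: nc; rewrite ltr_pdivrMr// mulrC.
have [t t0 pt1] := down_probability_gt0 k.+1.
have [T T0 S] := IH _ (mulr_gt0 e0 pt1).
exists T => //; rewrite -(ler_pM2r pt1); apply: le_trans S.
by apply: le_trans (survival_ge_via _ _ t0 T0) (survival_nincr _ T0 t0).
Qed.

Lemma survival_cvg0 k : (0 < k)%N -> survival T k @[T --> +oo] --> 0.
Proof.
move=> k0; apply/cvgrPdist_le => e e0.
have [T T0 Se] := survival_small k0 e0.
near=> x.
have Tx : T <= x by near: x; apply: nbhs_pinfty_ge; rewrite num_real.
rewrite sub0r normrN ger0_norm ?survival_ge0 ?(le_trans T0)//.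
apply: le_trans Se; rewrite -(subrKC T x); apply: survival_nincr => //.
by rewrite subr_ge0.
Unshelve. all: by end_near.
Qed.

Lemma survival_0 k : survival 0 k = pi k.
Proof.
apply: EFin_inj; rewrite -survivalE// (nneseriesD1 (n := k))//; last first.
  by move=> i _; rewrite lee_fin mulr_ge0 ?p0.
rewrite (tf_0 tf) eqxx mulr1 eseries0 ?adde0// => i _ /= ik.
by rewrite (tf_0 tf) (negPf ik) mulr0.
Qed.

Lemma restart_flow_lipschitz k T t : 0 <= T -> 0 <= t ->
  `|restart_flow k (T + t) - restart_flow k T| <= K * (K * t).
Proof.
move=> T0 t0; have Kt : 0 <= K * t by rewrite mulr_ge0.
have Tt : 0 <= T + t by rewrite addr_ge0.
have A : restart_flow k (T + t) <= restart_flow k T + K * (K * t).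
  apply: restart_flow_le => // l; have := transition_lipschitz l k t0 T0.
  by rewrite ler_norml => /andP[_]; rewrite lerBlDl.
have B : restart_flow k T <= restart_flow k (T + t) + K * (K * t).
  apply: restart_flow_le => // l; have := transition_lipschitz l k t0 T0.
  by rewrite ler_norml => /andP[+ _]; lra.
by rewrite ler_norml; apply/andP; split; lra.
Qed.

Lemma integral_restart_flow k :
  (\int[lebesgue_measure]_(t in `[0%R, +oo[) (restart_flow k t)%:E
   = \sum_(1 <= j <oo) (Qt 0%N j)%:E * mstar p k j)%E.
Proof.
have mD : measurable (`[0%R, +oo[%classic : set R) by [].
have mp j : measurable_fun (`[0%R, +oo[%classic : set R) (fun t => p t j k).
  apply: subspace_continuous_measurable_fun => //.
  by apply: (lipschitz_within K0) => T t T0 t0; exact: transition_lipschitz.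
transitivity (\int[lebesgue_measure]_(t in `[0%R, +oo[)
    \sum_(0 <= l <oo) ((0 < l)%:R * Qt 0%N l * p t l k)%:E)%E.
  apply: eq_integral => t; rewrite inE/= in_itv/= andbT => t0.
  by rewrite restart_flowE.
rewrite integral_nneseries//; last 2 first.
- move=> l; apply/measurable_EFinP.
  by apply: measurable_funM; [exact: measurable_cst|exact: mp].
- by move=> l t /=; rewrite in_itv/= andbT => t0; rewrite lee_fin mulr_ge0 ?p0.
rewrite [RHS]eseries_cond [RHS]eseries_mkcond; apply: eq_eseriesr => l _ /=.
under eq_integral do rewrite EFinM.
rewrite ge0_integralZl//; last 3 first.
- by apply/measurable_EFinP; exact: mp.
- by move=> t /=; rewrite in_itv/= andbT => t0; rewrite pE0.
- by rewrite lee_fin.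
by case: l => [|l]; rewrite ?mul0r ?mul0e ?mul1r.
Qed.

(** The survival probabilities decrease from [pi k] to 0, at the rate
    [pi 0 * restart_flow k]. *)
Lemma equilibrium_occupation k : (0 < k)%N ->
  ((pi k)%:E = (pi 0%N)%:E * \sum_(1 <= j <oo) (Qt 0%N j)%:E * mstar p k j)%E.
Proof.
move=> k0; rewrite -integral_restart_flow -survival_0.
have <- : (\int[lebesgue_measure]_(T in `[0%R, +oo[) (pi 0%N * restart_flow k T)%:E
    = (survival 0 k)%:E)%E.
  apply: (integral_of_decrease (F := survival^~ k) (C := C)
    (L := pi 0%N * (K * K))).
  - exact: C0.
  - by rewrite !mulr_ge0.
  - by move=> T t T0 t0; exact: survival_increment.
  - move=> T t T0 t0; rewrite -mulrBr normrM ger0_norm// -mulrA -mulrA ler_wpM2l//.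
    exact: restart_flow_lipschitz.
  - by move=> T T0; rewrite mulr_ge0 ?restart_flow_ge0.
  - exact: survival_cvg0.
under eq_integral do rewrite EFinM.
rewrite ge0_integralZl//; last 2 first.
- by move=> t /=; rewrite in_itv/= andbT => t0; rewrite lee_fin restart_flow_ge0.
- by rewrite lee_fin.
apply/measurable_EFinP; apply: subspace_continuous_measurable_fun => //.
apply: (lipschitz_within (mulr_ge0 K0 K0)) => T t T0 t0.
by rewrite -mulrA; exact: restart_flow_lipschitz.
Qed.

End Occupation.

(** * The left derivative at 1 of the batch generating function *)

Lemma cvg_series_of_nneseries (R : realType) (u : nat -> R) (l : R) :
  (forall j, 0 <= u j) -> (\sum_(0 <= j <oo) (u j)%:E = l%:E)%E ->
  series u n @[n --> \oo] --> l.
Proof.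
move=> u0 ul.
have : (\sum_(0 <= j < n) (u j)%:E)%E @[n --> \oo] --> l%:E.
  rewrite -ul; apply: is_cvg_nneseries => n _ _; by rewrite lee_fin.
move=> /fine_cvg; apply: cvg_trans; apply: near_eq_cvg; near=> n.
by rewrite /= sumEFin.
Unshelve. all: by end_near.
Qed.

Section LeftDerivativeAtOne.
Variables (R : realType) (b : nat -> R).
Hypothesis b_ge0 : forall j, j != 1%N -> 0 <= b j.
Hypothesis b1_lt0 : 0 < - b 1%N.
Hypothesis b_cons : (\sum_(0 <= j <oo | j != 1%N) (b j)%:E = (- b 1%N)%:E)%E.

Definition customer_arrival_rate : \bar R :=
  (\sum_(2 <= j <oo) (j.-1%:R * b j)%:E)%E.

Lemma series_b_cvg0 : series b n @[n --> \oo] --> 0.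
Proof.
pose u j := if j != 1%N then b j else 0.
have u0 j : 0 <= u j by rewrite /u; case: ifP => // /b_ge0.
have : series u n @[n --> \oo] --> - b 1%N.
  apply: cvg_series_of_nneseries => //; rewrite -b_cons [RHS]eseries_mkcond.
  by apply: eq_eseriesr => j _; rewrite /u; case: ifP.
move=> H; rewrite -(addNr (b 1%N)).
have E n : series u n.+2 + b 1%N = series b n.+2.
  rewrite /series/=; elim: n => [|n IH].
    by rewrite !big_nat_recr//= !big_geq// /u/= addr0 !add0r.
  by rewrite big_nat_recr//= addrAC IH [RHS]big_nat_recr.
have : series u n + b 1%N @[n --> \oo] --> - b 1%N + b 1%N.
  by apply: cvgD => //; exact: cvg_cst.
apply: cvg_trans; apply: near_eq_cvg; near=> n.
have n2 : (2 <= n)%N by near: n; exact: nbhs_infty_ge.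
have -> : n = n.-2.+2 by lia.
exact: E.
Unshelve. all: by end_near.
Qed.

Lemma series_abs_b_cvg : cvgn (series (fun j => `|b j|)).
Proof.
apply/cvg_ex; exists (- b 1%N - b 1%N); apply: cvg_series_of_nneseries => //.
rewrite (nneseriesD1 (n := 1%N))// EFinB -EFinN; congr (_ + _)%E.
  by rewrite ltr0_norm// -oppr_gt0.
rewrite -b_cons; apply: eq_eseriesr => j j1; rewrite ger0_norm//.
exact: b_ge0.
Qed.

(** The [j]-th term [b j * (y ^+ j - 1) / (y - 1)] of the difference quotient,
    less the summand [i = 0] of the geometric sum: this discards the only
    negative coefficient [b 1]. *)
Definition slope_term (y : R) (j : nat) : R := b j * \sum_(1 <= i < j) y ^+ i.

Lemma slope_term_ge0 y j : 0 <= y -> 0 <= slope_term y j.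
Proof.
move=> y0; rewrite /slope_term; have [->|j1] := eqVneq j 1%N.
  by rewrite big_geq// mulr0.
by rewrite mulr_ge0 ?b_ge0// sumr_ge0// => i _; rewrite exprn_ge0.
Qed.

Lemma slope_series_nd y : 0 <= y ->
  {homo series (slope_term y) : n m / (n <= m)%N >-> n <= m}.
Proof.
move=> y0; apply/nondecreasing_seqP => n; rewrite seriesS lerDr.
exact: slope_term_ge0.
Qed.

Lemma pseries_cvg y : 0 <= y <= 1 -> cvgn (pseries b y).
Proof.
move=> /andP[y0 y1]; apply: normed_cvg.
apply: (series_le_cvg _ _ _ series_abs_b_cvg) => n; do ?exact: normr_ge0.
by rewrite /= normrM ler_piMr// ger0_norm ?exprn_ge0// exprn_ile1.
Qed.

Lemma pseries_slope y n : y != 1 ->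
  (pseries b y n.+1 - pseries b 1 n.+1) / (y - 1)
  = series (slope_term y) n.+1 + (series b n.+1 - b 0%N).
Proof.
move=> y1; have y10 : y - 1 != 0 by rewrite subr_eq0.
have -> : series b n.+1 - b 0%N = \sum_(0 <= j < n.+1) (0 < j)%:R * b j.
  rewrite /series/= !big_nat_recl// mul0r add0r addrAC subrr add0r.
  by apply: eq_bigr => j _; rewrite mul1r.
rewrite /pseries /series/= -sumrB mulr_suml -big_split/=.
apply: eq_bigr => j _; rewrite -mulrBr expr1n /slope_term.
case: j => [|j]; first by rewrite expr0 subrr mulr0 big_geq// mulr0 !mul0r addr0.
rewrite subrX1 mulrA mulrAC mulfK// mul1r.
rewrite -(big_mkord xpredT (fun i => y ^+ i)) big_nat_recl// expr0 mulrDr mulr1 addrC.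
by rewrite big_add1.
Qed.

Lemma slope_series_cvg y : 0 < y < 1 ->
  series (slope_term y) n @[n --> \oo] --> (B b y - B b 1) / (y - 1) + b 0%N.
Proof.
move=> /andP[y0 y1]; rewrite -(cvg_shiftS (series (slope_term y))).
have H : (pseries b y n.+1 - pseries b 1 n.+1) / (y - 1) - (series b n.+1 - b 0%N)
   @[n --> \oo] --> (B b y - B b 1) / (y - 1) - (0 - b 0%N).
  apply: cvgB.
    apply: cvgM; last exact: cvg_cst.
    apply: cvgB.
      rewrite (cvg_shiftS (pseries b y)); apply: pseries_cvg.
      by rewrite (ltW y0) (ltW y1).
    rewrite (cvg_shiftS (pseries b 1)); apply: pseries_cvg.
    by rewrite ler01 lexx.
  apply: cvgB; last exact: cvg_cst.
  by rewrite (cvg_shiftS (series b)); exact: series_b_cvg0.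
rewrite sub0r opprK in H; apply: cvg_trans H; apply: near_eq_cvg; near=> n.
by rewrite /= pseries_slope ?(lt_eqF y1)// addrK.
Unshelve. all: by end_near.
Qed.

Lemma customer_arrival_rateE :
  (customer_arrival_rate = \sum_(0 <= j <oo) (slope_term 1 j)%:E)%E.
Proof.
rewrite /customer_arrival_rate eseries_cond [LHS]eseries_mkcond.
apply: eq_eseriesr => j _; rewrite /slope_term.
case: j => [|[|j]]/=; [by rewrite big_geq ?mulr0..|].
under eq_bigr do rewrite expr1n.
by rewrite big_const_nat iter_addr addr0 mulrC subn1.
Qed.

(** Up to the constant [b 0] the difference quotients are sums of nonnegative
    terms that increase to [j.-1 * b j] as the argument increases to 1, so
    monotone convergence computes their limit, finite or not. *)
Lemma slope_cvg :
  ((B b y - B b 1) / (y - 1) + b 0%N)%:E @[y --> 1^'-] --> customer_arrival_rate.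
Proof.
have nn j : (0 <= (slope_term 1 j)%:E)%E by rewrite lee_fin slope_term_ge0.
pose D y := (B b y - B b 1) / (y - 1) + b 0%N.
have Dle y : 0 < y < 1 -> ((D y)%:E <= customer_arrival_rate)%E.
  move=> y01; have /andP[y0 y1] := y01; rewrite customer_arrival_rateE.
  have Dc := slope_series_cvg y01.
  have: (series (slope_term y) n)%:E @[n --> \oo] --> (D y)%:E.
    by apply: cvg_EFin => //; near=> n.
  move=> /cvg_lim <-//; apply: lime_le.
    by apply/cvg_ex; exists (D y)%:E; apply: cvg_EFin => //; near=> n.
  near=> n; rewrite /series/= -sumEFin.
  apply: le_trans (nneseries_lim_ge n (fun j _ _ => nn j)).
  apply: lee_sum => j _; rewrite lee_fin /slope_term.
  have [->|j1] := eqVneq j 1%N; first by rewrite !big_geq.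
  rewrite ler_wpM2l ?b_ge0// ler_sum// => i _.
  by rewrite expr1n exprn_ile1// ltW.
have Dgt a : (a%:E < customer_arrival_rate)%E -> \forall y \near 1^'-, a < D y.
  rewrite customer_arrival_rateE => aM.
  have [n an] : exists n, a < series (slope_term 1) n.
    apply: contrapT => H; move: aM; apply/negP; rewrite -leNgt.
    apply: lime_le; first by apply: is_cvg_nneseries => j _ _; exact: nn.
    near=> n; rewrite sumEFin lee_fin leNgt; apply/negP => an.
    by apply: H; exists n.
  pose P : {poly R} := \sum_(0 <= j < n) b j *: \sum_(1 <= i < j) 'X^i.
  have PE y : P.[y] = series (slope_term y) n.
    rewrite /P horner_sum; apply: eq_bigr => j _.
    rewrite hornerZ horner_sum; congr (_ * _).
    by apply: eq_bigr => i _; rewrite hornerXn.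
  have : \forall y \near 1^'-, a < P.[y].
    apply: (cvgr_gt P.[1]); last by rewrite PE.
    apply: cvg_at_left_filter; exact: continuous_horner.
  move=> aP; near=> y.
  have y1 : y < 1 by near: y; exact: nbhs_left_lt.
  have y0 : 0 < y by near: y; exact: nbhs_left_gt.
  have y01 : 0 < y < 1 by rewrite y0.
  have Dc := slope_series_cvg y01.
  apply: lt_le_trans (_ : P.[y] <= _); first by near: y.
  rewrite PE /D -(cvg_lim _ Dc)//; apply: nondecreasing_cvgn_le.
    exact: slope_series_nd (ltW y0).
  by apply/cvg_ex; exists (D y).
have D01 : \forall y \near 1^'-, ((D y)%:E <= customer_arrival_rate)%E.
  near=> y; apply: Dle; apply/andP; split; near: y.
    exact: nbhs_left_gt.
  exact: nbhs_left_lt.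
move: Dgt D01; have : (0 <= customer_arrival_rate)%E.
  by rewrite customer_arrival_rateE; apply: nneseries_ge0 => j _ _; exact: nn.
case: customer_arrival_rate => [m| |]// _ Dgt D01; last first.
  by apply/cvgeyPgt => A; near do rewrite lte_fin; apply: Dgt; exact: ltry.
apply: cvg_EFin; first by near=> y.
apply/cvgrPdist_lt => e e0.
have := Dgt (m - e) ltac:(by rewrite lte_fin ltrBlDr ltrDl).
apply: filterS2 D01 => y; rewrite lee_fin => Dm Dme.
by rewrite ger0_norm ?subr_ge0//= ltrBlDr -ltrBlDl.
Unshelve. all: by end_near.
Qed.

Lemma dBc1E c : (dBc1 c b = customer_arrival_rate - (c%:R * b 0%N)%:E)%E.
Proof.
rewrite /dBc1 /left_derivative; apply: cvg_lim => //.
have : (((B b y - B b 1) / (y - 1) + b 0%N)%:E - (c%:R * b 0%N)%:E)%E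
    @[y --> 1^'-] --> (customer_arrival_rate - (c%:R * b 0%N)%:E)%E.
  apply: cvgeB; [|exact: slope_cvg|exact: cvg_cst].
  by rewrite fin_num_adde_defl.
apply: cvg_trans; apply: near_eq_cvg; near=> y.
have y1 : y - 1 != 0 by rewrite subr_eq0 lt_eqF//; near: y; exact: nbhs_left_lt.
by rewrite -EFinB /Bc; congr EFin; field.
Unshelve. all: by end_near.
Qed.

End LeftDerivativeAtOne.

(** * Expectations of functions of a discrete random variable *)

Lemma expectation_nat (R : realType) (d : measure_display)
    (Omega : measurableType d) (P : probability Omega R) (N : {RV P >-> nat})
    (pi f : nat -> R) :
  (forall k, distribution P N [set k] = (pi k)%:E) -> (forall k, 0 <= f k) ->
  ('E_P[fun w => f (N w)] = \sum_(0 <= k <oo) (f k * pi k)%:E)%E.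
Proof.
move=> NE f0; rewrite unlock.
have mf (g : nat -> \bar R) : measurable_fun [set: nat] g by [].
rewrite -(ge0_integral_distribution N (mf (fun k => (f k)%:E))) /=; last first.
  by move=> k; rewrite lee_fin.
transitivity (\int[distribution P N]_k
    (\sum_(0 <= j <oo) (f j)%:E * (\1_[set j] k)%:E))%E.
  apply: eq_integral => k _; rewrite (nneseriesD1 (n := k))//; last first.
    by move=> j _; rewrite mule_ge0 ?lee_fin.
  rewrite indicE mem_set// mule1 eseries0 ?adde0// => j _ /= jk.
  by rewrite indicE memNset ?mule0//= => /esym/eqP; rewrite (negPf jk).
rewrite integral_nneseries//; last first.
  by move=> j k _; rewrite mule_ge0 ?lee_fin.
apply: eq_eseriesr => j _; rewrite ge0_integralZl ?lee_fin//.
  rewrite integral_indic// setIT EFinM; congr (_ * _)%E; exact: NE.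
Qed.

(** * The rates of the bulk queue *)

Section BulkQueueRates.
Variables (R : realType) (c : nat) (b h : nat -> R).
Hypothesis c_ge1 : (1 <= c)%N.
Hypothesis b_ge0 : forall j, j != 1%N -> 0 <= b j.
Hypothesis b_cons : (\sum_(0 <= j <oo | j != 1%N) (b j)%:E = (- b 1%N)%:E)%E.
Hypothesis b0_gt0 : 0 < b 0%N.
Hypothesis h_ge0 : forall j, (1 <= j)%N -> 0 <= h j.
Hypothesis h_fin : (total_resurrection_rate h < +oo)%E.
Implicit Types (i j k m n : nat) (F : nat -> R).

Let Qs := Qstar c b.
Let Qt := Qtilde c b h.
Let up := upward Qt.

Lemma upward_batch i j : (0 < i)%N -> up i j = if (i < j)%N then b (j - i + 1)%N else 0.
Proof.
case: i => // i _; rewrite /up /upward /Qt /Qtilde /Qstar /=.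
by case: ltnP => // ij; rewrite eqSS (gtn_eqF (ltnW ij)) (gtn_eqF ij).
Qed.

Lemma upward_resurrection j : up 0 j = if (0 < j)%N then h j else 0.
Proof. by rewrite /up /upward; case: j. Qed.

Lemma up_ge0 i j : 0 <= up i j.
Proof.
case: i => [|i]; first by rewrite upward_resurrection; case: ifP => // /h_ge0.
rewrite upward_batch//; case: ltnP => // ij.
by apply: b_ge0; rewrite addn1 eqSS subn_eq0 -ltnNge.
Qed.

(** [b m] is the arrival rate of batches of [m.-1] customers. *)
Lemma sum_upward_batch i F : (0 < i)%N -> (forall j, 0 <= F j) ->
  (\sum_(0 <= j <oo) (up i j * F j)%:E
   = \sum_(2 <= m <oo) (b m * F (i + m.-1)%N)%:E)%E.
Proof.
move=> i0 F0.
have upF0 j : (0 <= (up i j * F j)%:E)%E by rewrite lee_fin mulr_ge0 ?up_ge0.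
transitivity (\sum_(i.+1 <= j <oo) (up i j * F j)%:E)%E.
  rewrite -[RHS]eseries_lower; apply: eq_eseriesr => j _.
  by case: ltnP => // ji; rewrite upward_batch// ltnNge ji mul0r.
rewrite -[LHS]nneseries_addn//.
pose g m := (if (1 < m)%N then b m * F (i + m.-1)%N else 0)%:E.
have g0 m : (0 <= g m)%E.
  rewrite /g; case: ltnP => // m1; rewrite lee_fin mulr_ge0// b_ge0//.
  by rewrite gtn_eqF.
transitivity (\sum_(2 <= m <oo) g m)%E; last first.
  rewrite -[LHS]eseries_lower -[RHS]eseries_lower.
  by apply: eq_eseriesr => m _ /=; rewrite /g; case: ltnP.
rewrite -[RHS]nneseries_addn//; apply: eq_eseriesr => l _.
rewrite /g addn2/= upward_batch// addnS ltnS leq_addl; congr (b _ * F _)%:E; clear; lia.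
Qed.

Lemma sum_upward_resurrection F :
  (\sum_(0 <= j <oo) (up 0 j * F j)%:E = \sum_(1 <= j <oo) (h j * F j)%:E)%E.
Proof.
rewrite -[RHS]eseries_lower; apply: eq_eseriesr => j _.
by rewrite upward_resurrection; case: ifP => //; rewrite mul0r.
Qed.

Lemma batch_rate : (\sum_(2 <= m <oo) (b m)%:E = (- b 1%N - b 0%N)%:E)%E.
Proof.
have := b_cons; rewrite (nneseriesD1 (n := 0%N))//.
rewrite (_ : (\sum_(0 <= k <oo | (k != 1%N) && (k != 0%N)) _
  = \sum_(2 <= m <oo) (b m)%:E)%E); last first.
  rewrite [RHS]eseries_cond; apply: eq_eseriesl => k /=; clear; lia.
case: (\sum_(2 <= m <oo) _)%E => // r [] H; congr EFin; lra.
Qed.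

Let tot := fine (total_resurrection_rate h).

Lemma totE : total_resurrection_rate h = tot%:E.
Proof.
rewrite fineK// ge0_fin_numE// /total_resurrection_rate eseries_cond.
by apply: nneseries_ge0 => j _ /= j1; rewrite lee_fin h_ge0.
Qed.

Lemma tot_ge0 : 0 <= tot.
Proof.
rewrite -lee_fin -totE /total_resurrection_rate eseries_cond.
by apply: nneseries_ge0 => j _ /= j1; rewrite lee_fin h_ge0.
Qed.

Lemma batch_rate_ge0 : 0 <= - b 1%N - b 0%N.
Proof.
rewrite -lee_fin -batch_rate eseries_cond.
by apply: nneseries_ge0 => j _ /= j1; rewrite lee_fin b_ge0// gtn_eqF.
Qed.

Lemma downE n : Qt n.+1 n = (minn n.+1 c)%:R * b 0%N.
Proof. by rewrite /Qt /Qtilde /Qstar /= eqxx. Qed.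

Lemma down_gt0 n : 0 < Qt n.+1 n.
Proof. by rewrite downE mulr_gt0// ltr0n leq_min. Qed.

Lemma queue_skip_free i j : (j.+1 < i)%N -> Qt i j = 0.
Proof.
case: i => // i; rewrite ltnS /Qt /Qtilde /Qstar /= => ji.
rewrite eqSS (ltn_eqF ji) (ltn_eqF (ltnW ji : (j < i.+1)%N)).
by rewrite ltnNge leqW ?(ltnW ji).
Qed.

Lemma queue_row i : (0 < i)%N ->
  (\sum_(0 <= j <oo | j != i) (Qt i j)%:E = (- Qt i i)%:E)%E.
Proof.
move=> i0.
transitivity (\sum_(0 <= j <oo)
    ((if j.+1 == i then (minn i c)%:R * b 0%N else 0)%:E + (up i j * 1)%:E))%E.
  rewrite eseries_mkcond; apply: eq_eseriesr => j _.
  rewrite -EFinD upward_batch// mulr1 /Qt /Qtilde /Qs /Qstar (gtn_eqF i0).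
  have [->|ji] /= := eqVneq j i; first by rewrite ltnn gtn_eqF// addr0.
  case: eqP => [ij|_]; last by rewrite add0r.
  by case: ltnP => [|_]; [lia|rewrite addr0].
have m0 : 0 <= (minn i c)%:R * b 0%N by rewrite mulr_ge0// ltW.
rewrite nneseriesD; last 2 first.
- by move=> j _ _; case: ifP; rewrite lee_fin.
- by move=> j _ _; rewrite lee_fin mulr1 up_ge0.
rewrite sum_upward_batch//; under [in X in (_ + X)%E]eq_eseriesr do rewrite mulr1.
rewrite batch_rate (nneseriesD1 (n := i.-1))//; last first.
  by move=> j _; case: ifP; rewrite lee_fin.
rewrite prednK// eqxx eseries0 ?adde0; last first.
  by move=> j _ /= ji; case: eqP => // ij; exfalso; lia.
rewrite -EFinD; congr EFin.
by rewrite /Qt /Qtilde /Qstar (gtn_eqF i0) gtn_eqF// eqxx; ring.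
Qed.

Let K := - b 1%N + c%:R * b 0%N + tot.

Lemma queue_exit_le i : (0 < i)%N -> - Qt i i <= K.
Proof.
move=> i0; rewrite /Qt /Qtilde /Qstar (gtn_eqF i0) gtn_eqF// eqxx /K.
have := tot_ge0; have mc : (minn i c)%:R <= c%:R :> R by rewrite ler_nat geq_minr.
have : (minn i c)%:R * b 0%N <= c%:R * b 0%N by rewrite ler_wpM2r// ltW.
by have := ltW b0_gt0; lra.
Qed.

Lemma queue_offdiag_ge0 i j : (0 < i)%N -> j != i -> 0 <= Qt i j.
Proof.
move=> i0 ji; rewrite /Qt /Qtilde /Qstar (gtn_eqF i0) (negPf ji).
case: eqP => _; first by rewrite mulr_ge0// ltW.
case: ltnP => // ij.
by apply: b_ge0; rewrite addn1 eqSS subn_eq0 -ltnNge.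
Qed.

Lemma stopped_bounded_conservative : bounded_conservative K Qs.
Proof.
have K0 : 0 <= K.
  have := tot_ge0; have := batch_rate_ge0; rewrite /K.
  have : 0 <= c%:R * b 0%N by rewrite mulr_ge0// ltW.
  by have := ltW b0_gt0; lra.
have same i j : (0 < i)%N -> Qs i j = Qt i j by case: i.
split=> [[|i] j ji|[|i]|[|i]].
- by [].
- by rewrite same// queue_offdiag_ge0.
- by rewrite eseries0// /Qs /Qstar /= oppr0.
- by rewrite same// -queue_row//; apply: eq_eseriesr.
- by rewrite /Qs /Qstar/= oppr0.
- by rewrite same// queue_exit_le.
Qed.

Lemma resurrected_bounded_conservative : bounded_conservative K Qt.
Proof.
split=> [[|i] j ji|[|i]|[|i]].
- by rewrite /Qt /Qtilde/= (negPf ji) h_ge0// lt0n.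
- exact: queue_offdiag_ge0.
- rewrite /Qt /Qtilde/= opprK -/tot -totE /total_resurrection_rate.
  rewrite [RHS]eseries_cond [LHS]eseries_mkcond [RHS]eseries_mkcond.
  by apply: eq_eseriesr => -[].
- exact: queue_row.
- rewrite /Qt /Qtilde/= opprK /K -/tot lerDr addr_ge0//.
    by have := batch_rate_ge0; have := ltW b0_gt0; lra.
  by rewrite mulr_ge0// ltW.
- exact: queue_exit_le.
Qed.

End BulkQueueRates.

(** * Moments of the equilibrium queue length *)

Lemma sum_double_from (i l : nat) :
  (\sum_(i <= n < i + l) n.*2 = l * (i.*2 + l.-1))%N.
Proof.
elim: l => [|l IH]; first by rewrite addn0 big_geq.
rewrite addnS big_nat_recr ?leq_addr//= IH; case: l {IH} => [|l] /=; nia.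
Qed.

Section EquilibriumMoments.
Variables (R : realType) (c : nat) (b h : nat -> R).
Variables (pt : R -> nat -> nat -> R) (pi : nat -> R).
Hypothesis c_ge1 : (1 <= c)%N.
Hypothesis b_ge0 : forall j, j != 1%N -> 0 <= b j.
Hypothesis b1_lt0 : 0 < - b 1%N.
Hypothesis b_cons : (\sum_(0 <= j <oo | j != 1%N) (b j)%:E = (- b 1%N)%:E)%E.
Hypothesis b0_gt0 : 0 < b 0%N.
Hypothesis h_ge0 : forall j, (1 <= j)%N -> 0 <= h j.
Hypothesis h_gt0 : (0 < total_resurrection_rate h)%E.
Hypothesis h_fin : (total_resurrection_rate h < +oo)%E.
Hypothesis tft : transition_function pt.
Hypothesis ptQ : has_qmatrix pt (Qtilde c b h).
Hypothesis dBc1_lt0 : (dBc1 c b < 0)%E.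
Hypothesis mu1_fin : (mu1 h < +oo)%E.
Hypothesis eqd : equilibrium_distribution pt pi.

Let Qt := Qtilde c b h.
Let bct := resurrected_bounded_conservative c_ge1 b_ge0 b_cons b0_gt0 h_ge0 h_fin.
Let pi0 k : 0 <= pi k. Proof. exact: (eq_ge0 eqd). Qed.
Let piE0 k : (0 <= (pi k)%:E)%E. Proof. by rewrite lee_fin. Qed.

Let b2_ge0 m : (2 <= m)%N -> 0 <= b m.
Proof. by move=> m2; rewrite b_ge0// gtn_eqF. Qed.

(** The service rate [minn k c * b 0] is [c * b 0] less the capacity of the idle
    servers; this correction involves finitely many states only. *)
Lemma weighted_drift (w : nat -> R) : (forall n, 0 <= w n) ->
  (\sum_(1 <= k <oo) (w k.-1 * (c%:R * b 0%N * pi k))%:E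
   = (pi 0%N)%:E * (\sum_(1 <= j <oo) (h j * \sum_(0 <= n < j) w n)%:E)
     + (\sum_(1 <= i <oo) (pi i)%:E *
         \sum_(2 <= m <oo) (b m * \sum_(i <= n < i + m.-1) w n)%:E)
     + (\sum_(1 <= k < c) w k.-1 * (pi k * (c%:R - k%:R) * b 0%N))%:E)%E.
Proof.
move=> w0; have b00 := ltW b0_gt0.
have W0 i j : 0 <= \sum_(i <= n < j) w n by rewrite sumr_ge0.
rewrite -nneseries_from1; last by move=> k; rewrite lee_fin !mulr_ge0.
pose f n := (w n * (pi n.+1 * (c%:R - n.+1%:R) * b 0%N))%:E.
rewrite (eq_eseriesr (g := fun n => ((w n * (pi n.+1 * Qt n.+1 n))%:E
   + (if (n < c.-1)%N then `|f n| else 0))%E)); last first.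
  move=> n _; rewrite /Qt downE; case: ltnP => nc.
    have nc' : (n.+1 <= c)%N by lia.
    rewrite (minn_idPl nc') gee0_abs; last first.
      by rewrite lee_fin !mulr_ge0// subr_ge0 ler_nat.
    by rewrite -EFinD; congr EFin; rewrite /=; ring.
  have nc' : (c <= n.+1)%N by lia.
  by rewrite (minn_idPr nc') adde0; congr EFin; ring.
rewrite nneseriesD; last 2 first.
- by move=> n _ _; rewrite lee_fin /Qt downE !mulr_ge0.
- by move=> n _ _; case: ifP => // _; exact: abse_ge0.
rewrite (nneseries_upper _ (fun n => abse_ge0 (f n))).
have SF := queue_skip_free c b h.
rewrite (drift_balance tft ptQ bct SF eqd w0) nneseries_recl//; last first.
  move=> k _; rewrite mule_ge0 ?nneseries_ge0// => j _ _.
  by rewrite lee_fin mulr_ge0// up_ge0.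
congr (_ * _ + _ + _)%E.
- exact: sum_upward_resurrection.
- apply: eq_eseries_from => i i1; congr (_ * _)%E.
  exact: (sum_upward_batch c b_ge0 h_ge0 i1).
rewrite -sumEFin big_add1/=; apply: eq_big_nat => n /andP[_ nc].
by rewrite ger0_norm// !mulr_ge0// subr_ge0 ler_nat; lia.
Qed.

Let beta := fine (customer_arrival_rate b).
Let mu := fine (mu1 h).

Lemma customer_arrival_rate_ge0 : (0 <= customer_arrival_rate b)%E.
Proof.
rewrite /customer_arrival_rate eseries_cond; apply: nneseries_ge0 => m _ /= m2.
by rewrite lee_fin mulr_ge0 ?b2_ge0.
Qed.

Lemma customer_arrival_rate_fin : customer_arrival_rate b = beta%:E.
Proof.
rewrite fineK// ge0_fin_numE ?customer_arrival_rate_ge0//.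
move: dBc1_lt0; rewrite dBc1E//.
by case: (customer_arrival_rate b) => //= r _; exact: ltry.
Qed.

Lemma dBc1_fin : dBc1 c b = (beta - c%:R * b 0%N)%:E.
Proof. by rewrite dBc1E// customer_arrival_rate_fin. Qed.

Lemma beta_ge0 : 0 <= beta.
Proof. by rewrite -lee_fin -customer_arrival_rate_fin customer_arrival_rate_ge0. Qed.

Lemma mu1E : mu1 h = mu%:E.
Proof.
rewrite fineK// ge0_fin_numE// /mu1 eseries_cond; apply: nneseries_ge0 => m _ /= m1.
by rewrite lee_fin mulr_ge0 ?h_ge0.
Qed.

Lemma mu_gt0 : 0 < mu.
Proof.
rewrite -lte_fin -mu1E; apply: lt_le_trans h_gt0 _.
apply: le_nneseries_from => j j1; first by rewrite lee_fin h_ge0.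
by rewrite lee_fin ler_peMl ?h_ge0// ler1n.
Qed.

Lemma busy_mass : (\sum_(1 <= k <oo) (pi k)%:E = (1 - pi 0%N)%:E)%E.
Proof.
have := eq_sum1 eqd; rewrite nneseries_recl// EFinB => <-.
by rewrite addeAC subee// add0e.
Qed.

Let X := \sum_(1 <= k < c) pi k * (c%:R - k%:R) * b 0%N.

Lemma X_ge0 : 0 <= X.
Proof.
rewrite /X big_nat_cond sumr_ge0// => k /andP[/andP[_ kc] _].
by rewrite !mulr_ge0 ?(ltW b0_gt0)// subr_ge0 ler_nat ltnW.
Qed.

(** The weights [w n = 1] give the drift of the queue length itself. *)
Lemma first_balance :
  c%:R * b 0%N * (1 - pi 0%N) = pi 0%N * mu + (1 - pi 0%N) * beta + X.
Proof.
have := weighted_drift (w := fun=> 1) (fun=> ler01).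
under eq_eseriesr do rewrite mul1r EFinM.
rewrite nneseriesZl// busy_mass -EFinM.
have -> : (\sum_(1 <= j <oo) (h j * \sum_(0 <= n < j) 1)%:E = mu%:E)%E.
  rewrite -mu1E; apply: eq_eseriesr => j _.
  by rewrite sumr_const_nat subn0 mulrC.
under [in X in (_ + X + _)%E]eq_eseriesr => i _.
  under eq_eseriesr => m _ do rewrite sumr_const_nat addKn mulrC.
  rewrite -/(customer_arrival_rate b) customer_arrival_rate_fin muleC.
  over.
rewrite nneseriesZl// busy_mass.
under [in X in (_ + X)%E]eq_bigr do rewrite mul1r.
by rewrite -!EFinM -!EFinD => -[->]; rewrite (mulrC beta).
Qed.

(** Otherwise [first_balance] would make [mu] vanish. *)
Lemma pi0_lt1 : pi 0%N < 1.
Proof.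
have pi01 : pi 0%N <= 1.
  have : (0 <= (1 - pi 0%N)%:E)%E by rewrite -busy_mass nneseries_ge0.
  by rewrite lee_fin subr_ge0.
rewrite lt_neqAle pi01 andbT; apply/eqP => E.
have := first_balance; rewrite E subrr mulr0 mul0r addr0 mul1r.
by have := mu_gt0; have := X_ge0; lra.
Qed.

(** Were state 0 never visited, the cut equations would empty all states. *)
Lemma pi0_gt0 : 0 < pi 0%N.
Proof.
rewrite lt_neqAle pi0 andbT; apply/eqP => /esym E.
have SF := queue_skip_free c b h.
have Z k : pi k = 0.
  elim/ltn_ind: k => -[//|k] IH.
  have := cut_balance tft ptQ bct SF eqd k.
  rewrite big1; last by move=> i _; rewrite IH ?mul0e.
  move=> [] /esym/eqP; rewrite mulf_eq0 => /orP[/eqP//|].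
  by rewrite (gt_eqF (down_gt0 h c_ge1 b0_gt0 k)).
have := eq_sum1 eqd; rewrite eseries0; last by move=> k _ _; rewrite Z.
by move=> [] /eqP; rewrite eq_sym oner_eq0.
Qed.

Definition mean_queue : \bar R := (\sum_(0 <= k <oo) (k%:R * pi k)%:E)%E.

Let V := mean_queue.
Let B2 := ddBc1 b.
Let H2 := ddH1 h.
Let X2 := \sum_(1 <= k < c) k.-1.*2%:R * (pi k * (c%:R - k%:R) * b 0%N).

Lemma ddBc1_ge0 : (0 <= B2)%E.
Proof.
rewrite /B2 /ddBc1 eseries_cond; apply: nneseries_ge0 => m _ /= m2.
by rewrite lee_fin mulr_ge0 ?b2_ge0.
Qed.

Lemma ddH1_ge0 : (0 <= H2)%E.
Proof.
rewrite /H2 /ddH1 eseries_cond; apply: nneseries_ge0 => m _ /= m2.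
by rewrite lee_fin mulr_ge0 ?h_ge0 ?(ltnW m2).
Qed.

Lemma mean_queue_ge0 : (0 <= V)%E.
Proof. by apply: nneseries_ge0 => k _ _; rewrite lee_fin mulr_ge0. Qed.

Lemma mean_queueE : (V = \sum_(1 <= k <oo) (k%:R * pi k)%:E)%E.
Proof.
rewrite /V /mean_queue nneseries_recl//; last first.
  by move=> k _; rewrite lee_fin mulr_ge0.
by rewrite mul0r add0e.
Qed.

Lemma resurrection_square_drift :
  (\sum_(1 <= j <oo) (h j * \sum_(0 <= n < j) n.*2%:R)%:E = H2)%E.
Proof.
rewrite -[LHS]eseries_lower /H2 /ddH1 -[RHS]eseries_lower.
apply: eq_eseriesr => j _; rewrite -natr_sum -[j in \sum_(0 <= _ < j) _]add0n.
by rewrite sum_double_from mulrC add0n; case: j => [|[|j]]//=; rewrite mul0r.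
Qed.

Lemma batch_square_drift i :
  (\sum_(2 <= m <oo) (b m * \sum_(i <= n < i + m.-1) n.*2%:R)%:E
    + (2 * beta)%:E = (2 * beta * i%:R)%:E + B2)%E.
Proof.
have T (x : R) : 0 <= x ->
    ((x * beta)%:E = \sum_(2 <= m <oo) (x * (m.-1%:R * b m))%:E)%E.
  move=> x0; rewrite EFinM -customer_arrival_rate_fin /customer_arrival_rate.
  rewrite -nneseriesZl_from; first by apply: eq_eseriesr.
  by move=> m m2; rewrite lee_fin mulr_ge0 ?b2_ge0.
have W0 m : 0 <= \sum_(i <= n < i + m.-1) n.*2%:R :> R by rewrite sumr_ge0.
rewrite mulrAC !T ?mulr_ge0// /B2 /ddBc1 -!nneseriesD; last 4 first.
- by move=> m m2 _; rewrite lee_fin !mulr_ge0 ?b2_ge0.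
- by move=> m m2 _; rewrite lee_fin !mulr_ge0 ?b2_ge0.
- by move=> m m2 _; rewrite lee_fin !mulr_ge0 ?b2_ge0.
- by move=> m m2 _; rewrite lee_fin !mulr_ge0 ?b2_ge0.
apply: eq_eseries_from => -[|[|m]]// _; rewrite -!EFinD; congr EFin.
rewrite -natr_sum sum_double_from /= !natrM natrD -muln2 natrM -!natr1; ring.
Qed.

(** For [x = +oo] both sides are infinite because [pi 0 < 1]. *)
Lemma busy_average (x : \bar R) : (0 <= x)%E ->
  (\sum_(1 <= i <oo) (pi i)%:E * x = (1 - pi 0%N)%:E * x)%E.
Proof.
case: x => [r r0| _|//].
  under eq_eseriesr do rewrite muleC.
  by rewrite nneseriesZl// busy_mass muleC.
have [k k1 pik] : exists2 k, (1 <= k)%N & 0 < pi k.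
  apply: contrapT => H; have := busy_mass; rewrite eseries0.
    by move=> [] /eqP; rewrite eq_sym subr_eq0 gt_eqF// pi0_lt1.
  move=> k k1 _; congr EFin; apply/eqP; rewrite eq_le pi0 andbT leNgt.
  by apply/negP => pik; apply: H; exists k.
rewrite gt0_muley ?lte_fin ?subr_gt0 ?pi0_lt1// eseries_cond.
apply: (nneseries_pinfty (k := k)) => //; last by rewrite gt0_muley.
by move=> n _; rewrite mule_ge0.
Qed.

(** The weights [w n = 2 * n] give the drift of the test function [k * k.-1],
    written without subtractions so that it also makes sense when some of the
    moments are infinite. *)
Lemma second_balance :
  ((2 * (c%:R * b 0%N))%:E * V + (2 * beta * (1 - pi 0%N))%:E
   = (pi 0%N)%:E * H2 + ((2 * beta)%:E * V + (1 - pi 0%N)%:E * B2)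
     + (X2 + 2 * (c%:R * b 0%N) * (1 - pi 0%N))%:E)%E.
Proof.
have b00 := ltW b0_gt0; have beta0 := beta_ge0.
have W0 i m : 0 <= \sum_(i <= n < i + m.-1) n.*2%:R :> R by rewrite sumr_ge0.
have cb0 : 0 <= 2 * (c%:R * b 0%N) by rewrite !mulr_ge0.
have -> : ((2 * (c%:R * b 0%N))%:E * V
    = \sum_(1 <= k <oo) (k.-1.*2%:R * (c%:R * b 0%N * pi k))%:E
      + (2 * (c%:R * b 0%N) * (1 - pi 0%N))%:E)%E.
  rewrite mean_queueE [in RHS](EFinM _ (1 - pi 0%N)) -busy_mass -!nneseriesZl//; last first.
    by move=> k _; rewrite lee_fin mulr_ge0.
  rewrite -nneseriesD//.
  - apply: eq_eseries_from => -[|k]// _; rewrite -!EFinM -EFinD; congr EFin.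
    by rewrite /= -muln2 natrM -natr1; ring.
  - by move=> k _ _; rewrite lee_fin !mulr_ge0.
  - by move=> k _ _; rewrite mule_ge0 ?lee_fin.
have := weighted_drift (w := fun n => n.*2%:R) (fun n => ler0n _ _).
rewrite /= resurrection_square_drift => ->.
have -> : ((2 * beta)%:E * V + (1 - pi 0%N)%:E * B2
   = \sum_(1 <= i <oo) (pi i)%:E *
       (\sum_(2 <= m <oo) (b m * \sum_(i <= n < i + m.-1) n.*2%:R)%:E)
     + (2 * beta * (1 - pi 0%N))%:E)%E.
  have S0 i : (0 <= \sum_(2 <= m <oo) (b m * \sum_(i <= n < i + m.-1) n.*2%:R)%:E)%E.
    rewrite eseries_cond; apply: nneseries_ge0 => m _ /= m2.
    by rewrite lee_fin mulr_ge0 ?b2_ge0.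
  have b2 : 0 <= 2 * beta by rewrite mulr_ge0.
  rewrite (mulrC _ (1 - pi 0%N)) (EFinM (1 - pi 0%N)).
  rewrite -(busy_average ddBc1_ge0) -(@busy_average (2 * beta)%:E) ?lee_fin//.
  rewrite mean_queueE -!nneseriesZl; last by move=> k _; rewrite lee_fin mulr_ge0.
  rewrite -!nneseriesD; last 4 first.
  - by move=> k _ _; rewrite mule_ge0.
  - by move=> k _ _; rewrite mule_ge0 ?lee_fin.
  - by move=> k _ _; rewrite mule_ge0 ?lee_fin// mulr_ge0.
  - by move=> k _ _; rewrite mule_ge0 ?ddBc1_ge0.
  apply: eq_eseriesr => i _.
  rewrite -ge0_muleDr ?lee_fin// batch_square_drift.
  rewrite ge0_muleDr ?ddBc1_ge0 ?lee_fin ?mulr_ge0//.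
  by rewrite -!EFinM; congr (_%:E + _)%E; ring.
rewrite (EFinD X2) -!addeA; congr (_ + (_ + _))%E.
by rewrite addeA addeC.
Qed.

(** Cutting the weights off at [M] makes the left-hand side of the drift
    identity finite; the negative mean drift then bounds the truncated mean
    uniformly in [M]. *)
Lemma mean_queue_fin : B2 \is a fin_num -> H2 \is a fin_num -> (V < +oo)%E.
Proof.
move=> B2f H2f.
have b00 := ltW b0_gt0; have beta0 := beta_ge0.
have cb0 : 0 <= c%:R * b 0%N by rewrite mulr_ge0.
pose VM n := \sum_(0 <= k < n.+1) k%:R * pi k.
pose D := fine H2 + fine B2 + X2 + 2 * (c%:R * b 0%N).
have gap : 0 < 2 * (c%:R * b 0%N - beta).
  by move: dBc1_lt0; rewrite dBc1_fin lte_fin; lra.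
have bound M : VM M <= D / (2 * (c%:R * b 0%N - beta)).
  rewrite ler_pdivlMr//.
  pose w n : R := if (n < M)%N then n.*2%:R else 0.
  have w0 n : 0 <= w n by rewrite /w; case: ifP.
  have wle n : w n <= n.*2%:R by rewrite /w; case: ifP.
  have W0 i j : 0 <= \sum_(i <= n < j) w n by rewrite sumr_ge0.
  have := weighted_drift w0.
  set G0 := (\sum_(1 <= j <oo) (h j * _)%:E)%E.
  set GS := (\sum_(1 <= i <oo) (pi i)%:E * _)%E.
  have G0le : (G0 <= H2)%E.
    rewrite -resurrection_square_drift; apply: le_nneseries_from => j j1.
      by rewrite lee_fin mulr_ge0 ?W0 ?h_ge0.
    by rewrite lee_fin ler_wpM2l ?h_ge0// ler_sum.
  have mass_le1 m : \sum_(m <= k < M.+1) pi k <= 1.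
    have [mM|Mm] := leqP m M.+1; last by rewrite big_geq ?(ltnW Mm).
    rewrite -lee_fin -(eq_sum1 eqd).
    apply: le_trans (nneseries_lim_ge M.+1 (fun k _ _ => piE0 k)).
    by rewrite sumEFin lee_fin [leRHS](big_cat_nat (n := m))//= lerDr sumr_ge0.
  have fB0 : 0 <= fine B2 by rewrite fine_ge0 ?ddBc1_ge0.
  have GSle : (GS <= (2 * beta * VM M + fine B2)%:E)%E.
    pose g i := ((pi i)%:E * (2 * beta * i%:R + fine B2)%:E)%E.
    have g0 i : (0 <= g i)%E by rewrite mule_ge0// lee_fin addr_ge0// !mulr_ge0.
    apply: (@le_trans _ _ (\sum_(0 <= i < M.+1) g i)%E); last first.
      rewrite /g; under eq_bigr do rewrite -EFinM.
      rewrite sumEFin lee_fin; under eq_bigr do rewrite mulrDr.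
      rewrite big_split/= -mulr_suml /VM mulr_sumr.
      under eq_bigr do rewrite mulrCA (mulrC (pi _)).
      by rewrite lerD2l ler_piMl.
    rewrite -nneseries_upper// /GS -[leLHS]eseries_lower.
    have S0 i : (0 <= \sum_(2 <= m <oo) (b m * \sum_(i <= n < i + m.-1) w n)%:E)%E.
      rewrite eseries_cond; apply: nneseries_ge0 => m _ /= m2.
      by rewrite lee_fin mulr_ge0 ?b2_ge0 ?W0.
    apply: lee_nneseries => [i _ _|i _]; first by case: ifP => // _; rewrite mule_ge0.
    case: ifP => _; last by case: ifP.
    rewrite ltnS; case: leqP => [iM|Mi]; last first.
      rewrite eseries0 ?mule0// => m _ _; rewrite big1_seq ?mulr0// => n.
      rewrite mem_index_iota => /andP[_ /andP[ni _]]; rewrite /w ltnNge.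
      by rewrite (leq_trans (ltnW Mi) ni).
    rewrite /g lee_wpmul2l// EFinD fineK// -batch_square_drift.
    apply: le_trans (leeDl _ _); last by rewrite lee_fin mulr_ge0.
    apply: le_nneseries_from => m m2; first by rewrite lee_fin mulr_ge0 ?b2_ge0 ?W0.
    by rewrite lee_fin ler_wpM2l ?b2_ge0// ler_sum.
  have X2le : \sum_(1 <= k < c) w k.-1 * (pi k * (c%:R - k%:R) * b 0%N) <= X2.
    rewrite /X2 big_nat_cond [leRHS]big_nat_cond ler_sum// => k /andP[/andP[_ kc] _].
    by rewrite ler_wpM2r// !mulr_ge0// subr_ge0 ler_nat ltnW.
  have L : ((2 * (c%:R * b 0%N) * VM M - 2 * (c%:R * b 0%N))%:E
      <= \sum_(1 <= k <oo) (w k.-1 * (c%:R * b 0%N * pi k))%:E)%E.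
    have t0 k : (0 <= (w k.-1 * (c%:R * b 0%N * pi k))%:E)%E.
      by rewrite lee_fin mulr_ge0// mulr_ge0.
    apply: le_trans (nneseries_lim_ge M.+1 (fun k _ _ => t0 k)).
    rewrite sumEFin lee_fin /VM big_nat_recl// mul0r add0r big_add1/=.
    have m1 := mass_le1 1%N; rewrite big_add1/= in m1.
    rewrite [leRHS](eq_big_nat _ _ (F2 := fun k =>
      2 * (c%:R * b 0%N) * (k.+1%:R * pi k.+1)
      - 2 * (c%:R * b 0%N) * pi k.+1)); last first.
      by move=> k /andP[_ kM]; rewrite /w /= kM -muln2 natrM -natr1; ring.
    rewrite sumrB -!mulr_sumr lerD2l lerN2 ler_piMr// mulr_ge0//.
  move=> E; rewrite E in L.
  have : ((2 * (c%:R * b 0%N) * VM M - 2 * (c%:R * b 0%N))%:E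
      <= H2 + (2 * beta * VM M + fine B2)%:E + X2%:E)%E.
    apply: le_trans L _; rewrite !leeD// ?lee_fin//.
    apply: le_trans G0le; rewrite -[leRHS]mul1e lee_wpmul2r ?lee_fin ?(ltW pi0_lt1)//.
    rewrite /G0 eseries_cond; apply: nneseries_ge0 => j _ /= j1.
    by rewrite lee_fin mulr_ge0 ?W0 ?h_ge0.
  rewrite -(fineK H2f) -!EFinD lee_fin /D; lra.
apply: le_lt_trans (ltry (D / (2 * (c%:R * b 0%N - beta)))).
apply: lime_le.
  by apply: is_cvg_nneseries => k _ _; rewrite lee_fin mulr_ge0.
apply: nearW => n; rewrite sumEFin lee_fin; apply: le_trans (bound n).
by rewrite /VM big_nat_recr//= lerDl mulr_ge0.
Qed.

Let B' := beta - c%:R * b 0%N.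

Lemma B'_lt0 : B' < 0.
Proof. by move: dBc1_lt0; rewrite dBc1_fin lte_fin. Qed.

(** [second_balance] solved for the mean, with the sum over the states with idle
    servers eliminated by [first_balance]. *)
Lemma mean_queue_value : B2 \is a fin_num -> H2 \is a fin_num ->
  (V = (pi 0%N * (fine B2 * mu / (2 * B' ^+ 2) - (2 * mu + fine H2) / (2 * B'))
        + \sum_(1 <= k < c) pi k * (c%:R - k%:R) * b 0%N
            * (fine B2 / (2 * B' ^+ 2) - k%:R / B'))%:E)%E.
Proof.
move=> B2f H2f.
have Vf : V \is a fin_num.
  by rewrite ge0_fin_numE ?mean_queue_ge0// mean_queue_fin.
pose Y := \sum_(1 <= k < c) pi k * (c%:R - k%:R) * b 0%N * k%:R.
have X2E : X2 = 2 * Y - 2 * X.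
  rewrite /X2 /Y /X !mulr_sumr -sumrB; apply: eq_big_nat => -[|k]// _.
  by rewrite /= -muln2 natrM -natr1; ring.
have -> : \sum_(1 <= k < c) pi k * (c%:R - k%:R) * b 0%N
    * (fine B2 / (2 * B' ^+ 2) - k%:R / B') = X * (fine B2 / (2 * B' ^+ 2)) - Y / B'.
  by rewrite /X /Y !mulr_suml -sumrB; apply: eq_bigr => k _; ring.
have := second_balance; rewrite -(fineK Vf) -(fineK B2f) -(fineK H2f).
rewrite -!EFinM -!EFinD => -[]; rewrite X2E.
have := first_balance; have := B'_lt0.
move: (fine V) (fine B2) (fine H2) => v s u B'0 E1 E2; congr EFin.
have B'n : B' != 0 by rewrite lt_eqF.
have XE : X = - B' * (1 - pi 0%N) - pi 0%N * mu by rewrite /B'; lra.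
have : - (2 * B') * v = pi 0%N * u + (1 - pi 0%N) * s + 2 * Y + 2 * pi 0%N * mu.
  by rewrite /B' in XE *; lra.
move=> E3; apply: (mulfI (_ : - (2 * B') != 0)).
  by rewrite oppr_eq0 mulf_neq0.
by rewrite E3 XE /=; field.
Qed.

(** In [second_balance] the factors [pi 0] and [1 - pi 0] of the second moments
    are positive. *)
Lemma mean_queue_infty : ~~ ((B2 \is a fin_num) && (H2 \is a fin_num)) -> V = +oo%E.
Proof.
apply: contraNeq => Voo.
have Vf : V \is a fin_num by rewrite ge0_fin_numE ?mean_queue_ge0// ltey.
have := second_balance; rewrite -(fineK Vf) -!EFinM -!EFinD.
have pp : (0 < (pi 0%N)%:E)%E by rewrite lte_fin pi0_gt0.
have qp : (0 < (1 - pi 0%N)%:E)%E by rewrite lte_fin subr_gt0 pi0_lt1.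
have := ddBc1_ge0; have := ddH1_ge0.
case: H2 => [u| |]//; case: B2 => [s| |]// _ _; rewrite -?EFinM.
- by rewrite gt0_muley//.
- by rewrite gt0_muley//.
- by rewrite !gt0_muley//.
Qed.

(** Pointwise, [(k - c) + c = k + (c - k)] for truncated subtractions. *)
Lemma mean_waiting :
  ((\sum_(0 <= k <oo) ((k - c)%N%:R * pi k)%:E) + c%:R%:E
   = V + (pi 0%N * c%:R + \sum_(1 <= k < c) pi k * (c%:R - k%:R))%:E)%E.
Proof.
have -> : ((c%:R : R)%:E = \sum_(0 <= k <oo) (c%:R * pi k)%:E)%E.
  under eq_eseriesr do rewrite EFinM.
  by rewrite nneseriesZl// (eq_sum1 eqd) mule1.
rewrite -nneseriesD; last 2 first.
- by move=> k _ _; rewrite lee_fin mulr_ge0.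
- by move=> k _ _; rewrite lee_fin mulr_ge0.
have -> : pi 0%N * c%:R + \sum_(1 <= k < c) pi k * (c%:R - k%:R)
    = \sum_(0 <= k < c) (c - k)%N%:R * pi k.
  rewrite [RHS]big_ltn// subn0 mulrC; congr (_ + _).
  by apply: eq_big_nat => k /andP[_ kc]; rewrite natrB 1?mulrC// ltnW.
have t0 k : (0 <= ((c - k)%N%:R * pi k)%:E)%E by rewrite lee_fin mulr_ge0.
rewrite -sumEFin -(nneseries_upper _ t0) /V /mean_queue -nneseriesD; last 2 first.
- by move=> k _ _; rewrite lee_fin mulr_ge0.
- by move=> k _ _; case: ifP.
apply: eq_eseriesr => k _; rewrite -EFinD -mulrDl -natrD.
case: ltnP => kc; last by rewrite adde0 subnK.
rewrite -EFinD -mulrDl -natrD; congr (_%:R * _)%:E.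
by clear -kc; lia.
Qed.

Lemma idle_probability (r : nat -> \bar R) :
  (forall k, (1 <= k < c)%N -> ((pi k)%:E = (pi 0%N)%:E * r k)%E) ->
  pi 0%N = - B' / (- B' + mu
             + \sum_(1 <= k < c) fine (r k) * (c%:R - k%:R) * b 0%N).
Proof.
move=> rE; have p0 := pi0_gt0.
have fE k : (1 <= k < c)%N -> pi k = pi 0%N * fine (r k).
  move=> /rE; case: (r k) => [x|/=|/=].
  - by rewrite -EFinM => -[].
  - by rewrite gt0_muley ?lte_fin.
  - by rewrite gt0_muleNy ?lte_fin.
set S := \sum_(1 <= k < c) _.
have XS : X = pi 0%N * S.
  rewrite /X /S mulr_sumr; apply: eq_big_nat => k kc.
  by rewrite (fE _ kc); ring.
have E := first_balance; rewrite XS in E.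
have S0 : 0 <= S by rewrite -(pmulr_rge0 _ p0) -XS X_ge0.
have D0 : - B' + mu + S != 0.
  by rewrite gt_eqF//; have := mu_gt0; have := B'_lt0; lra.
by apply: (mulIf D0); rewrite divfK// /B'; lra.
Qed.

End EquilibriumMoments.

(** * Mean queue lengths in equilibrium *)

Theorem corollary3p2 (R : realType) (c : nat) (b h : nat -> R)
  (pstar ptilde : R -> nat -> nat -> R) (pi : nat -> R)
  (d : measure_display) (Omega : measurableType d) (P : probability Omega R)
  (N : {RV P >-> nat})
  (c_ge1 : (1 <= c)%N)
  (b_ge0 : forall j, j != 1%N -> 0 <= b j)
  (b1_lt0 : 0 < - b 1%N)
  (b_conservative : (\sum_(0 <= j <oo | j != 1%N) (b j)%:E = (- b 1%N)%:E)%E)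
  (b0_gt0 : 0 < b 0%N)
  (b_ge2_gt0 : (0 < \sum_(2 <= j <oo) (b j)%:E)%E)
  (h_ge0 : forall j, (1 <= j)%N -> 0 <= h j)
  (h_gt0 : (0 < total_resurrection_rate h)%E)
  (h_fin : (total_resurrection_rate h < +oo)%E)
  (pstar_tf : transition_function pstar)
  (pstar_Q : has_qmatrix pstar (Qstar c b))
  (ptilde_tf : transition_function ptilde)
  (ptilde_Q : has_qmatrix ptilde (Qtilde c b h))
  (dBc1_lt0 : (dBc1 c b < 0)%E)
  (mu1_fin : (mu1 h < +oo)%E)
  (pi_equilibrium : equilibrium_distribution ptilde pi)
  (N_equilibrium : forall k : nat, distribution P N [set k] = (pi k)%:E) :
  let B' := fine (dBc1 c b) in
  let B'' := fine (ddBc1 b) in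
  let mu := fine (mu1 h) in
  let H'' := fine (ddH1 h) in
  let r := resurrection_occupation h pstar in
  let finite_moments := (ddBc1 b \is a fin_num) && (ddH1 h \is a fin_num) in
  [/\ ('E_P[fun w => (N w)%:R])%E =
        (if finite_moments then
           (pi 0%N * (B'' * mu / (2 * B' ^+ 2) - (2 * mu + H'') / (2 * B'))
            + \sum_(1 <= k < c) pi k * (c%:R - k%:R) * b 0%N
                * (B'' / (2 * B' ^+ 2) - k%:R / B'))%:E
         else +oo)%E,
      ('E_P[fun w => (N w - c)%N%:R])%E =
        (if finite_moments then
           (pi 0%N * (B'' * mu / (2 * B' ^+ 2) - (2 * mu + H'') / (2 * B')
                      + c%:R)
            + \sum_(1 <= k < c) pi k * (c%:R - k%:R)
                * (b 0%N * (B'' / (2 * B' ^+ 2) - k%:R / B') + 1)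
            - c%:R)%:E
         else +oo)%E,
      pi 0%N = - B' / (- B' + mu
                 + \sum_(1 <= k < c) fine (r k) * (c%:R - k%:R) * b 0%N)
    & forall k : nat, (1 <= k < c)%N ->
        (pi k)%:E = ((pi 0%N)%:E * r k)%E ].
Proof.
move=> B' B'' mu H'' r finite_moments.
have rE k : (1 <= k < c)%N -> ((pi k)%:E = (pi 0%N)%:E * r k)%E.
  move=> /andP[k1 _].
  rewrite (equilibrium_occupation pstar_tf pstar_Q ptilde_tf ptilde_Q
    (stopped_bounded_conservative c_ge1 b_ge0 b_conservative b0_gt0 h_ge0 h_fin)
    (resurrected_bounded_conservative c_ge1 b_ge0 b_conservative b0_gt0 h_ge0 h_fin)
    _ _ _ pi_equilibrium k1)//; last 2 first.
  - by move=> [].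
  - by move=> n; exact: (down_gt0 h c_ge1 b0_gt0 n).
  by congr (_ * _)%E; apply: eq_eseries_from => -[].
have B'E : B' = fine (customer_arrival_rate b) - c%:R * b 0%N.
  by rewrite /B' (dBc1_fin b_ge0 b1_lt0 b_conservative dBc1_lt0).
have VE := mean_queue_value c_ge1 b_ge0 b1_lt0 b_conservative b0_gt0 h_ge0
  h_gt0 h_fin ptilde_tf ptilde_Q dBc1_lt0 mu1_fin pi_equilibrium.
have Voo := mean_queue_infty c_ge1 b_ge0 b1_lt0 b_conservative b0_gt0 h_ge0
  h_gt0 h_fin ptilde_tf ptilde_Q dBc1_lt0 mu1_fin pi_equilibrium.
rewrite -B'E in VE.
have WE := mean_waiting c_ge1 pi_equilibrium.
split => //.
- rewrite (expectation_nat N_equilibrium (f := fun k => k%:R))//.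
  rewrite -/(mean_queue pi) /finite_moments; case: ifPn => [/andP[Bf Hf]|].
    exact: VE.
  exact: Voo.
- rewrite (expectation_nat N_equilibrium (f := fun k => (k - c)%N%:R))//.
  move: WE; set W := (\sum_(0 <= k <oo) _)%E => WE.
  have {WE}-> : W = (mean_queue pi + (pi 0%N * c%:R
      + \sum_(1 <= k < c) pi k * (c%:R - k%:R) - c%:R)%:E)%E.
    by rewrite EFinB addeA -WE addeK.
  rewrite /finite_moments; case: ifPn => [/andP[Bf Hf]|/Voo ->//].
  rewrite (VE Bf Hf) -EFinD; congr EFin.
  rewrite -/B'' -/H'' -/mu.
  under [in RHS]eq_bigr do rewrite mulrDr mulr1 mulrA.
  by rewrite big_split/=; ring.
- rewrite B'E; exact: (idle_probability c_ge1 b_ge0 b1_lt0 b_conservative b0_gt0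
    h_ge0 h_gt0 h_fin ptilde_tf ptilde_Q dBc1_lt0 mu1_fin pi_equilibrium rE).
Qed.
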